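(* Let $B$ be the open unit ball of $\mathbb{R}^3$ and let $\mathbf{f} : B \to \mathcal{A}$ be a square integrable $\mathcal{A}$-valued monogenic function in $B$. Then, for every $0 \leq r < 1$, $$\mathcal{M}\left(\left(\tfrac{1}{2}\overline{D}\right)\mathbf{f},\, r\right) \;\leq\; \frac{8(3r+1)}{(1-r)^5}\left(\mathcal{M}_{\mathbf{f}}(1) - |\mathbf{Sc}\{\mathbf{f}(0)\}|\right).$$
   Context: $\mathbb{H}$ is the skew field of real quaternions with basis $1, \mathbf{e}_1, \mathbf{e}_2, \mathbf{e}_3$ and multiplication rules $\mathbf{e}_1^2=\mathbf{e}_2^2=\mathbf{e}_3^2=-1$, $\mathbf{e}_1\mathbf{e}_2=\mathbf{e}_3=-\mathbf{e}_2\mathbf{e}_1$, $\mathbf{e}_2\mathbf{e}_3=\mathbf{e}_1=-\mathbf{e}_3\mathbf{e}_2$, $\mathbf{e}_3\mathbf{e}_1=\mathbf{e}_2=-\mathbf{e}_1\mathbf{e}_3$. The space of reduced quaternions is $\mathcal{A} := \mathrm{span}_{\mathbb{R}}\{1,\mathbf{e}_1,\mathbf{e}_2\} \subset \mathbb{H}$, identified with $\mathbb{R}^3$. For $\mathbf{x} = x_0 + x_1\mathbf{e}_1 + x_2\mathbf{e}_2 \in \mathcal{A}$, the scalar part is $\mathbf{Sc}(\mathbf{x}) = x_0$ and $|\mathbf{x}| = \sqrt{x_0^2+x_1^2+x_2^2}$ is the Euclidean norm. Points of $\mathbb{R}^3$ are written $x = (x_0,x_1,x_2)$, and $B = \{x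 \in \mathbb{R}^3 : |x| < 1\}$. An $\mathcal{A}$-valued function is $\mathbf{f} = [\mathbf{f}]_0 + [\mathbf{f}]_1\mathbf{e}_1 + [\mathbf{f}]_2\mathbf{e}_2$ with real-valued coordinates $[\mathbf{f}]_i$; continuity, differentiability and integrability are understood coordinate-wise. It is square integrable in $B$ if $\int_B |\mathbf{f}|^2\, dV < \infty$, where $dV$ is Lebesgue measure on $\mathbb{R}^3$. The generalized Cauchy-Riemann operator and its conjugate are $$D = \frac{\partial}{\partial x_0} + \mathbf{e}_1\frac{\partial}{\partial x_1} + \mathbf{e}_2\frac{\partial}{\partial x_2}, \qquad \overline{D} = \frac{\partial}{\partial x_0} - \mathbf{e}_1\frac{\partial}{\partial x_1} - \mathbf{e}_2\frac{\partial}{\partial x_2},$$ acting on functions from the left (with quaternionic multiplication). A continuously real-differentiable function $\mathbf{f}: B \to \mathcal{A}$ is called monogenic in $B$ if $D\mathbf{f} = 0$ in $B$. For such $\mathbf{f}$, the function $(\frac{1}{2}\overline{D})\mathbf{f}$ is called its hypercomplex derivative. For a function $\mathbf{f}$ on $B$, $$\mathcal{M}(\mathbf{f}, r) = \max_{|x|=r}|\mathbf{f}(x)| \quad (0 \leq r < 1), \qquad \mathcal{M}_{\mathbf{f}}(1) = \sup_{|\xi|<1}|\mathbf{f}(\xi)| \in [0,\infty].$$ If $\mathcal{M}_{\mathbf{f}}(1) = \infty$, the right-hand side of the inequality is understood as $+\infty$. *)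

(* Defs.v *)
From HB Require Import structures.
From mathcomp Require Import all_boot all_order all_algebra.
From mathcomp Require Import all_classical all_reals all_analysis.
From mathcomp Require Import ring.
Set Implicit Arguments.
Unset Strict Implicit.
Unset Printing Implicit Defensive.
Import Order.TTheory GRing.Theory Num.Theory.
Import numFieldNormedType.Exports.
Local Open Scope classical_set_scope.
Local Open Scope ring_scope.

(* A quaternion is the row vector of its coordinates in the basis
   1, e1, e2, e3; addition and real scaling are those of row vectors. *)
Definition quat (R : realType) : Type := 'rV[R]_4.

HB.instance Definition _ (R : realType) := GRing.Lmodule.on (quat R).

Definition qcoord (R : realType) (q : quat R) (i : 'I_4) : R :=
  (q : 'rV[R]_4) ord0 i.

Definition mkquat (R : realType) (a0 a1 a2 a3 : R) : quat R :=
  (\row_(i < 4) nth 0 [:: a0; a1; a2; a3] i : 'rV[R]_4).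

Notation "q `[ i ]q" := (qcoord q (inord i)) (at level 2, format "q `[ i ]q").

Section QuaternionRing.
Variable R : realType.
Implicit Types p q : quat R.

Definition qone : quat R := mkquat 1 0 0 0.

Definition qmul p q : quat R := mkquat
  (p`[0]q * q`[0]q - p`[1]q * q`[1]q - p`[2]q * q`[2]q - p`[3]q * q`[3]q)
  (p`[0]q * q`[1]q + p`[1]q * q`[0]q + p`[2]q * q`[3]q - p`[3]q * q`[2]q)
  (p`[0]q * q`[2]q - p`[1]q * q`[3]q + p`[2]q * q`[0]q + p`[3]q * q`[1]q)
  (p`[0]q * q`[3]q + p`[1]q * q`[2]q - p`[2]q * q`[1]q + p`[3]q * q`[0]q).

Lemma mkquatE (a0 a1 a2 a3 : R) :
  ((mkquat a0 a1 a2 a3)`[0]q = a0) * ((mkquat a0 a1 a2 a3)`[1]q = a1) *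
  ((mkquat a0 a1 a2 a3)`[2]q = a2) * ((mkquat a0 a1 a2 a3)`[3]q = a3).
Proof. by rewrite /qcoord /mkquat !mxE !inordK. Qed.

Lemma qcoordD p q i : qcoord (p + q) i = qcoord p i + qcoord q i.
Proof. exact: mxE. Qed.

Lemma qcoordN p i : qcoord (- p) i = - qcoord p i.
Proof. exact: mxE. Qed.

Lemma qcoordZ (a : R) p i : qcoord (a *: p) i = a * qcoord p i.
Proof. exact: mxE. Qed.

Lemma quatP p q : p`[0]q = q`[0]q -> p`[1]q = q`[1]q ->
  p`[2]q = q`[2]q -> p`[3]q = q`[3]q -> p = q.
Proof.
move=> h0 h1 h2 h3; apply/rowP => i.
rewrite -[i]inord_val; case: i => -[|[|[|[|//]]]] ? //=.
Qed.

Let qmulA : associative qmul.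
Proof. by move=> p q r; apply: quatP; rewrite !mkquatE; ring. Qed.
Let qmul1l : left_id qone qmul.
Proof. by move=> p; apply: quatP; rewrite !mkquatE; ring. Qed.
Let qmul1r : right_id qone qmul.
Proof. by move=> p; apply: quatP; rewrite !mkquatE; ring. Qed.
Let qmulDl : left_distributive qmul +%R.
Proof. by move=> p q r; apply: quatP; rewrite !(mkquatE, qcoordD); ring. Qed.
Let qmulDr : right_distributive qmul +%R.
Proof. by move=> p q r; apply: quatP; rewrite !(mkquatE, qcoordD); ring. Qed.
Let qone_neq0 : qone != 0.
Proof.
apply/eqP => /(congr1 (fun q : quat R => q`[0]q)).
by rewrite mkquatE [in RHS]/qcoord mxE => /eqP; rewrite oner_eq0.
Qed.

HB.instance Definition _ := GRing.Zmodule_isNzRing.Build (quat R)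
  qmulA qmul1l qmul1r qmulDl qmulDr qone_neq0.

Definition e1 : quat R := mkquat 0 1 0 0.
Definition e2 : quat R := mkquat 0 0 1 0.
Definition e3 : quat R := mkquat 0 0 0 1.

Lemma quat_rules :
  [/\ [/\ e1 * e1 = -1, e2 * e2 = -1 & e3 * e3 = -1],
      [/\ e1 * e2 = e3, e2 * e3 = e1 & e3 * e1 = e2] &
      [/\ e2 * e1 = - e3, e3 * e2 = - e1 & e1 * e3 = - e2]].
Proof.
by split; split; apply: quatP; rewrite ?qcoordN /GRing.mul /GRing.one /=
  !mkquatE; ring.
Qed.

Definition Sc q : R := q`[0]q.

(* Euclidean norm; the library norm on row vectors is the sup norm. *)
Definition qnorm q : R := Num.sqrt (\sum_(i < 4) qcoord q i ^+ 2).

Definition reduced_quat : set (quat R) := [set q | q`[3]q = 0].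

End QuaternionRing.

(* R^3 is the iterated product R * R * R, which carries both the product topology
   and the product sigma-algebra; (x0, x1, x2) is a pair ((x0, x1), x2). *)
Section ReducedMonogenic.
Variable R : realType.
Local Notation R3 := (R * R * R)%type.
Implicit Types (x v : R3) (U : set R3) (f g : R3 -> quat R).

(* Euclidean norm; the library norm on products is the sup norm. *)
Definition enorm3 x : R := Num.sqrt (x.1.1 ^+ 2 + x.1.2 ^+ 2 + x.2 ^+ 2).

Definition ball3 : set R3 := [set x | enorm3 x < 1].

Definition sphere3 (r : R) : set R3 := [set x | enorm3 x = r].

Definition lebesgue3 : set R3 -> \bar R :=
  ((@lebesgue_measure R \x @lebesgue_measure R) \x @lebesgue_measure R)%E.

Definition dir0 : R3 := (1, 0, 0).
Definition dir1 : R3 := (0, 1, 0).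
Definition dir2 : R3 := (0, 0, 1).

(* Functions on an open subset of R^3 are encoded as total functions; the
   notions below only depend on the values on that subset. *)

Definition partial v f x : quat R :=
  (\row_(i < 4) 'D_v (fun y => qcoord (f y) i) x : 'rV[R]_4).

Definition continuously_differentiable_on U f : Prop :=
  forall x, U x -> forall i : 'I_4,
    differentiable (fun y => qcoord (f y) i) x /\
    (forall v, v \in [:: dir0; dir1; dir2] ->
      {for x, continuous (fun y => qcoord (partial v f y) i)}).

Definition CauchyRiemann f x : quat R :=
  partial dir0 f x + e1 R * partial dir1 f x + e2 R * partial dir2 f x.

Definition conjCauchyRiemann f x : quat R :=
  partial dir0 f x - e1 R * partial dir1 f x - e2 R * partial dir2 f x.

Definition monogenic_on U f : Prop :=
  [/\ forall x, U x -> reduced_quat (f x),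
      continuously_differentiable_on U f &
      forall x, U x -> CauchyRiemann f x = 0].

Definition hypercomplex_derivative f x : quat R :=
  2^-1 *: conjCauchyRiemann f x.

(* For f continuous on U the integrand is measurable on U, so that finiteness of
   the integral is all there is to square integrability. *)
Definition square_integrable_on U f : Prop :=
  (\int[lebesgue3]_(x in U) (qnorm (f x) ^+ 2)%:E < +oo)%E.

(* For g continuous on the (nonempty, compact) sphere of radius r >= 0, this
   supremum is the maximum of the modulus of g on that sphere. *)
Definition max_modulus g (r : R) : \bar R :=
  ereal_sup [set (qnorm (g x))%:E | x in sphere3 r].

Definition sup_modulus f : \bar R :=
  ereal_sup [set (qnorm (f x))%:E | x in ball3].

End ReducedMonogenic.

(* Main.v *)
Require Import Defs.
From HB Require Import structures.
From mathcomp Require Import all_boot all_order all_algebra.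
From mathcomp Require Import all_classical all_reals all_analysis.
From mathcomp Require Import measurable_realfun ring lra.
Import Order.TTheory GRing.Theory Num.Theory.
Import numFieldNormedType.Exports.
Local Open Scope classical_set_scope.
Local Open Scope ring_scope.
Set Implicit Arguments.
Unset Strict Implicit.
Unset Printing Implicit Defensive.

(** Since D plus its conjugate is twice the derivative along x0, the hypercomplex
    derivative of a monogenic f is its derivative along x0. By the
    Cauchy-Riemann equations the coordinates of that derivative are, up to sign,
    the partial derivatives of f0 = Sc f, so its modulus is |grad f0|
    ([qnorm_hypercomplex_derivative]). Let M be the supremum of |f|, and let
    u = M - f0 or u = M + f0, with the sign for which u(0) = M - |f0(0)|. Then u
    is a nonnegative harmonic function, and the theorem bounds |grad u(x)| by a
    multiple of u(0).

    This follows from the local estimate (1 - |c|) |grad u(c)| <= 4 u(c)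
    ([gradient_le]). Along a radius it says that u(sx) (1 - s|x|)^4 is
    nonincreasing in s, hence u(x) (1 - |x|)^4 <= u(0) ([harnack_upper]); a second
    use of it at x gives (1 - r)^5 |grad u(x)| <= 4 u(0), and 4 <= 8 (3r + 1).

    The local estimate comes from mean values. To involve only the first
    derivatives of f, harmonicity of u is expressed by a first-order system for u
    and two conjugate functions F1, F2 ([riesz]). Let K be a radial kernel
    supported in the unit ball. The derivative in s of the integral of
    u(c + sy) K(y) is the integral of y . grad u(c + sy) K(y). The system rewrites
    this integrand as the sum over i = 1, 2 of
      (d_0 F_i) y_i K - (d_i F_i) y_0 K,
    and each term integrates to zero by parts because d_0 (y_i K) = d_i (y_0 K)
    ([radial_flux0]). So the integral of u(c + sy) K(y) does not depend on s
    ([radial_mean_value]). All integrands vanish outside the unit ball, so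
    integration over a box, iterated one variable at a time, is enough.

    The kernel is kappa = |y|^16 (1 - |y|^2)^2, together with K such that
    grad K = - 2 y kappa. Integration by parts turns the mean value of the
    derivative of u along e, weighted by K, into the integral of
    2 u(c + rho y) (y . e) kappa(y), which is at most 2 |e| u(c) times the integral
    of kappa since u >= 0 and |y . e| <= |e|. The divergence theorem evaluates the
    ratio of the integrals of K and kappa, and the resulting constant is 75/19
    ([gradient_estimate]). Kernels that concentrate on the sphere would give the
    optimal constant 3; with |y|^(2m) in place of |y|^16 the constant is
    3 (2m + 9) / (2m + 3), and m = 8 is the first exponent for which it is below
    4, the value that the exponent 5 of 1 - r leaves room for. *)

(** * Measurability of continuous functions and integration over a box *)

Section CaratheodoryMeasurable.
Context d (T : measurableType d) (R : realType).

(** A function of this kind is the pointwise limit of the functions obtained by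
    rounding y down to the grid of mesh 1/(n+1), and these are measurable because
    the grid is countable. This is how continuity on a product gives
    measurability for the product sigma-algebra. *)
Lemma measurable_fun_caratheodory (f : T * R -> R) :
  (forall y, measurable_fun setT (fun t => f (t, y))) ->
  (forall t, continuous (fun y => f (t, y))) ->
  measurable_fun setT f.
Proof.
move=> mf cf.
pose grid n (y : R) : R := (Num.floor (y * n.+1%:R))%:~R / n.+1%:R.
have cvg_grid y : grid n y @[n --> \oo] --> y.
  apply/cvgrPdist_lt => e e0; near=> n.
  have n0 : (0 : R) < n.+1%:R by rewrite ltr0n.
  have -> : y - grid n y =
      (y * n.+1%:R - (Num.floor (y * n.+1%:R))%:~R) / n.+1%:R.
    by rewrite mulrBl mulfK ?gt_eqF.
  have /andP[fl fu] := floor_itv (y * n.+1%:R).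
  rewrite intrD in fu.
  rewrite ger0_norm; last by rewrite divr_ge0 ?subr_ge0// ltW.
  apply: (@le_lt_trans _ _ n.+1%:R^-1).
    by rewrite ler_pdivrMr// mulVf ?gt_eqF//; lra.
  by near: n; exact: near_infty_natSinv_lt (PosNum e0).
refine (@measurable_fun_cvg _ _ _ _
  (fun n ty => f (ty.1, grid n ty.2)) _ _ _).
  move=> n _ /= Y mY; rewrite setTI.
  have -> : (fun ty : T * R => f (ty.1, grid n ty.2)) @^-1` Y =
    \bigcup_(k : int) ((fun t => f (t, k%:~R / n.+1%:R)) @^-1` Y `*`
      [set y : R | Num.floor (y * n.+1%:R) = k]).
    apply/seteqP; split=> [[t y] /= Yty|[t y] /= [k _ [/= Ytk ky]]].
      by exists (Num.floor (y * n.+1%:R)).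
    by rewrite /grid ky.
  apply: countable_bigcupT_measurable => [|k]; first exact: countableP.
  apply: measurableX.
    by rewrite -[X in measurable X]setTI; exact: mf.
  rewrite (_ : [set y : R | _] = `[k%:~R / n.+1%:R, (k + 1)%:~R / n.+1%:R[%classic).
    exact: measurable_itv.
  apply/seteqP; split=> y /=; rewrite in_itv/= ler_pdivrMr ?ltr0n//
    ltr_pdivlMr ?ltr0n//; first by move=> <-; exact: floor_itv.
  exact: floor_def.
by move=> [t y] _; exact: (cvg_comp _ _ (cvg_grid y) (cf t y)).
Unshelve. all: by end_near. Qed.

End CaratheodoryMeasurable.

Section Slices.
Context {T U V : topologicalType}.

Lemma continuous_pair1 (f : T * U -> V) (y : U) :
  continuous f -> continuous (fun t => f (t, y)).
Proof.
move=> cf t; apply: (@continuous_comp _ _ _ (fun s => (s, y)) f); last exact: cf.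
by apply: cvg_pair; [exact: cvg_id|exact: cvg_cst].
Qed.

Lemma continuous_pair2 (f : T * U -> V) (t : T) :
  continuous f -> continuous (fun y => f (t, y)).
Proof.
move=> cf y; apply: (@continuous_comp _ _ _ (fun s => (t, s)) f); last exact: cf.
by apply: cvg_pair; [exact: cvg_cst|exact: cvg_id].
Qed.

End Slices.

Section PlaneMeasure.
Context (R : realType).
Local Notation T := (measurableTypeR R).
Local Notation mu1 := (@lebesgue_measure R).

(** The plane measure has a name of its own so that it can carry its
    sigma-finiteness, which Fubini needs for the outer product. *)
Definition lebesgue2 : set (T * T)%type -> \bar R := (mu1 \x mu1)%E.

HB.instance Definition _ := Measure.copy lebesgue2 (mu1 \x mu1)%E.

Let lebesgue2_sigma_finite : sigma_finite setT lebesgue2.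
Proof.
pose I n : set T := `[- n%:R, n%:R]%classic.
have absI (x : R) n : (`|x| <= n%:R) -> I n x.
  by rewrite ler_norml /I /= in_itv.
exists (fun n => I n `*` I n).
  apply/seteqP; split=> // -[x y] _; exists (maxn (Num.trunc `|x|).+1 (Num.trunc `|y|).+1) => //.
  by split; apply: absI; rewrite (le_trans (ltW (truncnS_gt _)))// ler_nat
    ?leq_maxl ?leq_maxr.
move=> n; have mI : measurable (I n) by exact: measurable_itv.
split; first exact: measurableX.
rewrite [ltLHS](_ : _ = mu1 (I n) * mu1 (I n))%E; last exact: product_measure1E.
rewrite /I lebesgue_measure_itv/= lte_fin; case: ifP => _; last by rewrite mule0 ltry.
by rewrite -EFinB -EFinM ltry.
Qed.

HB.instance Definition _ := Measure_isSigmaFinite.Build _ _ _ lebesgue2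
  lebesgue2_sigma_finite.

End PlaneMeasure.

Section BoxIntegral.
Context {R : realType}.
Local Notation R3 := (R * R * R)%type.
Local Notation R2 := (R * R)%type.
Local Notation mu1 := (@lebesgue_measure R).
Local Notation mu2 := (@lebesgue2 R).
Local Notation mu3 := (mu2 \x mu1)%E.

Lemma continuous2_measurable (g : R2 -> R) : continuous g -> measurable_fun setT g.
Proof.
move=> cg; apply: measurable_fun_caratheodory => [y|t].
  apply: continuous_measurable_fun; exact: continuous_pair1.
exact: continuous_pair2.
Qed.

Lemma continuous3_measurable (g : R3 -> R) : continuous g -> measurable_fun setT g.
Proof.
move=> cg; apply: measurable_fun_caratheodory => [y|t].
  apply: continuous2_measurable; exact: continuous_pair1.
exact: continuous_pair2.
Qed.

Let side : set R := `[-1, 1]%classic.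
Definition square : set R2 := side `*` side.
Definition box : set R3 := square `*` side.

Lemma compact_square : compact square.
Proof. by apply: compact_setX; exact: segment_compact. Qed.

Lemma compact_box : compact box.
Proof. by apply: compact_setX; [exact: compact_square|exact: segment_compact]. Qed.

Let measurable_side : measurable side.
Proof. exact: measurable_itv. Qed.

Lemma measurable_square : measurable square.
Proof. by apply: measurableX. Qed.

Lemma measurable_box : measurable box.
Proof. by apply: measurableX => //; exact: measurable_square. Qed.

Let side_length : mu1 side = 2%:E.
Proof.
rewrite /side lebesgue_measure_itv/= lte_fin ifT; last lra.
by rewrite -EFinB opprK.
Qed.

Lemma square_volume : mu2 square = (2 * 2)%:E.
Proof.
transitivity (mu1 side * mu1 side)%E; first exact: product_measure1E.
by rewrite side_length.
Qed.

Lemma box_volume : mu3 box = (2 * 2 * 2)%:E.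
Proof.
transitivity (mu2 square * mu1 side)%E.
  by apply: product_measure1E => //; exact: measurable_square.
by rewrite square_volume side_length.
Qed.

Lemma compact_bounded_fun (T : topologicalType) (A : set T) (g : T -> R) :
  compact A -> {in A, continuous g} ->
  exists2 M : R, 0 <= M & forall x, A x -> `|g x| <= M.
Proof.
move=> cA cg.
have cgA : {within A, continuous g} by exact: continuous_in_subspaceT.
have [M [Mr gM]] := compact_bounded (continuous_compact cgA cA).
exists (`|M| + 1); first by rewrite addr_ge0.
by move=> x Ax; apply: gM; [rewrite (le_lt_trans (ler_norm _))// ltrDl|exists x].
Qed.

Lemma integrable_square (g : R2 -> R) : continuous g ->
  mu2.-integrable square (EFin \o g).
Proof.
move=> cg; apply: measurable_bounded_integrable.
- exact: measurable_square.
- by rewrite [ltLHS]square_volume ltry.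
- by apply: measurable_funTS; exact: continuous2_measurable.
- have [|M M0 gM] := @compact_bounded_fun _ _ g compact_square.
    by move=> x _; exact: cg.
  exists M; split; rewrite ?num_real// => N MN x Ax /=.
  by rewrite (le_trans (gM _ Ax))// ltW.
Qed.

Lemma integrable_box (g : R3 -> R) : continuous g ->
  mu3.-integrable box (EFin \o g).
Proof.
move=> cg; apply: measurable_bounded_integrable.
- exact: measurable_box.
- by rewrite [ltLHS]box_volume ltry.
- by apply: measurable_funTS; exact: continuous3_measurable.
- have [|M M0 gM] := @compact_bounded_fun _ _ g compact_box.
    by move=> x _; exact: cg.
  exists M; split; rewrite ?num_real// => N MN x Ax /=.
  by rewrite (le_trans (gM _ Ax))// ltW.
Qed.

Definition box_integral (g : R3 -> R) : R := \int[mu3]_(y in box) g y.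

End BoxIntegral.

(** * Fubini for integrals that vanish slice by slice *)

Section ProductSet.
Context d1 d2 (T1 : measurableType d1) (T2 : measurableType d2) (R : realType).
Variables (m1 : {sigma_finite_measure set T1 -> \bar R})
  (m2 : {sigma_finite_measure set T2 -> \bar R}).
Variables (A : set T1) (B : set T2) (f : T1 * T2 -> \bar R).
Hypotheses (mA : measurable A) (mB : measurable B)
  (intf : (m1 \x m2)%E.-integrable (A `*` B) f).

Lemma integral_setX0_snd : (forall x, A x -> \int[m2]_(y in B) f (x, y) = 0)%E ->
  (\int[m1 \x m2]_(p in A `*` B) f p = 0)%E.
Proof.
move=> f0; rewrite integral_mkcond -integral12_prod_meas1; last first.
  by rewrite -integrable_mkcond//; exact: measurableX.
apply: integral0_eq => x _; rewrite /fubini_F.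
have [xA|xA] := pselect (A x).
  rewrite -[RHS](f0 _ xA) [RHS]integral_mkcond; apply: eq_integral => y _.
  by rewrite !patchE in_setX mem_set.
by apply: integral0_eq => y _; rewrite patchE in_setX memNset.
Qed.

Lemma integral_setX0_fst : (forall y, B y -> \int[m1]_(x in A) f (x, y) = 0)%E ->
  (\int[m1 \x m2]_(p in A `*` B) f p = 0)%E.
Proof.
move=> f0; rewrite integral_mkcond -integral21_prod_meas1; last first.
  by rewrite -integrable_mkcond//; exact: measurableX.
apply: integral0_eq => y _; rewrite /fubini_G.
have [yB|yB] := pselect (B y).
  rewrite -[RHS](f0 _ yB) [RHS]integral_mkcond; apply: eq_integral => x _.
  by rewrite !patchE in_setX [X in _ && X]mem_set// andbT.
by apply: integral0_eq => x _; rewrite patchE in_setX [X in _ && X]memNset// andbF.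
Qed.
End ProductSet.

Section BoxIntegralTheory.
Context {R : realType}.
Local Notation R3 := (R * R * R)%type.
Local Notation R2 := (R * R)%type.
Local Notation mu1 := (@lebesgue_measure R).
Local Notation mu2 := (@lebesgue2 R).
Local Notation mu3 := (mu2 \x mu1)%E.
Local Notation side := (`[-1, 1]%classic : set R).
Implicit Types g h : R3 -> R.

Lemma box_integralD g h : continuous g -> continuous h ->
  box_integral (fun y => g y + h y) = box_integral g + box_integral h.
Proof.
by move=> cg ch; apply: RintegralD; [exact: measurable_box|exact: integrable_box..].
Qed.

Lemma box_integralB g h : continuous g -> continuous h ->
  box_integral (fun y => g y - h y) = box_integral g - box_integral h.
Proof.
by move=> cg ch; apply: RintegralB; [exact: measurable_box|exact: integrable_box..].
Qed.

Lemma box_integralZ g (a : R) : continuous g ->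
  box_integral (fun y => a * g y) = a * box_integral g.
Proof.
by move=> cg; apply: RintegralZl; [exact: measurable_box|exact: integrable_box].
Qed.

Lemma le_box_integral g h : continuous g -> continuous h ->
  (forall y, g y <= h y) -> box_integral g <= box_integral h.
Proof.
move=> cg ch gh; apply: le_Rintegral; [exact: measurable_box|exact: integrable_box..|].
by move=> y _; exact: gh.
Qed.

(** Fundamental theorem of calculus on [-1, 1] for a function that vanishes at
    both ends. *)
Lemma integral_side_derive (phi dphi : R -> R) :
  continuous dphi -> (forall t : R, is_derive t 1 phi (dphi t)) ->
  phi (-1) = 0 -> phi 1 = 0 ->
  (\int[mu1]_(t in side) (dphi t)%:E = 0)%E.
Proof.
move=> cd dp pN1 p1.
have cp : continuous phi.
  by move=> t; apply/differentiable_continuous/derivable1_diffP; exact: ex_derive.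
transitivity ((phi 1)%:E - (phi (-1))%:E)%E; last by rewrite p1 pN1 subee.
apply: continuous_FTC2.
- by rewrite gtrN.
- exact: continuous_subspaceT.
- split.
  + by move=> t _; exact: ex_derive.
  + exact/cvg_at_right_filter/cp.
  + exact/cvg_at_left_filter/cp.
- by move=> t _; rewrite derive1E derive_val.
Qed.

Lemma box_integral0_snd g : continuous g ->
  (forall p, \int[mu1]_(z in side) (g (p, z))%:E = 0)%E -> box_integral g = 0.
Proof.
move=> cg g0; rewrite /box_integral /Rintegral.
suff -> : (\int[mu3]_(y in box) (g y)%:E = 0)%E by [].
apply: (@integral_setX0_snd _ _ _ _ _ mu2 mu1); [exact: measurable_square|
  exact: measurable_itv|exact: integrable_box|].
by move=> p _; exact: g0.
Qed.

Lemma box_integral0_fst g : continuous g ->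
  (forall z, \int[mu2]_(p in square) (g (p, z))%:E = 0)%E -> box_integral g = 0.
Proof.
move=> cg g0; rewrite /box_integral /Rintegral.
suff -> : (\int[mu3]_(y in box) (g y)%:E = 0)%E by [].
apply: (@integral_setX0_fst _ _ _ _ _ mu2 mu1); [exact: measurable_square|
  exact: measurable_itv|exact: integrable_box|].
by move=> z _; exact: g0.
Qed.

Lemma integral_square0_snd (k : R2 -> R) : continuous k ->
  (forall x, \int[mu1]_(y in side) (k (x, y))%:E = 0)%E ->
  (\int[mu2]_(p in square) (k p)%:E = 0)%E.
Proof.
move=> ck k0; apply: (@integral_setX0_snd _ _ _ _ _ mu1 mu1) => [|||? _].
- exact: measurable_itv.
- exact: measurable_itv.
- exact: integrable_square.
- exact: k0.
Qed.

Lemma integral_square0_fst (k : R2 -> R) : continuous k ->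
  (forall y, \int[mu1]_(x in side) (k (x, y))%:E = 0)%E ->
  (\int[mu2]_(p in square) (k p)%:E = 0)%E.
Proof.
move=> ck k0; apply: (@integral_setX0_fst _ _ _ _ _ mu1 mu1) => [|||? _].
- exact: measurable_itv.
- exact: measurable_itv.
- exact: integrable_square.
- exact: k0.
Qed.

End BoxIntegralTheory.

(** * Integrals of partial derivatives *)

Section Lines.
Context {R : realType} {V W : normedModType R}.

(** Derivatives of functions on R^3 are computed along lines, where the calculus
    of one real variable applies; [line_is_derive] is the way back. *)
Lemma is_derive_line (g : V -> W) (x v : V) (t : R) (l : W) :
  is_derive (x + t *: v) v g l -> is_derive t (1 : R) (fun s : R => g (x + s *: v)) l.
Proof.
have E : (fun h : R => h^-1 *: (((fun s : R => g (x + s *: v)) \o shift t) (h *: (1 : R)) -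
      g (x + t *: v))) =
    (fun h : R => h^-1 *: ((g \o shift (x + t *: v)) (h *: v) - g (x + t *: v))).
  apply/funext => h /=; congr (_ *: (g _ - _)).
  by rewrite scalerDl [h%:A]mulr1 addrCA.
move=> [dg gl]; apply: DeriveDef.
  by rewrite /derivable E.
by rewrite -gl /derive E.
Qed.

Lemma line_is_derive (g : V -> W) (x v : V) (l : W) :
  is_derive 0 (1 : R) (fun s : R => g (x + s *: v)) l -> is_derive x v g l.
Proof.
have E : (fun h : R => h^-1 *: (((fun s : R => g (x + s *: v)) \o shift 0) (h *: (1 : R)) -
      g (x + 0 *: v))) =
    (fun h : R => h^-1 *: ((g \o shift x) (h *: v) - g x)).
  apply/funext => h /=; congr (_ *: (g _ - g _)).
    by rewrite addr0 [h%:A]mulr1 addrC.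
  by rewrite scale0r addr0.
move=> [dg gl]; apply: DeriveDef.
  by move: dg; rewrite /derivable E.
by rewrite -gl /derive E.
Qed.

End Lines.

Section Divergence.
Context {R : realType}.
Local Notation R3 := (R * R * R)%type.
Implicit Types g h : R3 -> R.

Definition norm2 (y : R3) : R := y.1.1 ^+ 2 + y.1.2 ^+ 2 + y.2 ^+ 2.

(** The divergence theorem in the only form used below: the function vanishes
    outside the unit ball, so integrating first along the direction of
    differentiation leaves no boundary term. *)
Lemma box_integral_partial (v : R3) g dg :
  v \in [:: dir0 R; dir1 R; dir2 R] -> continuous dg ->
  (forall y, is_derive y v g (dg y)) -> (forall y, 1 <= norm2 y -> g y = 0) ->
  box_integral dg = 0.
Proof.
move=> vdir cdg gdg g0.
have far (y : R3) : [|| y.1.1 ^+ 2 == 1, y.1.2 ^+ 2 == 1 | y.2 ^+ 2 == 1] -> g y = 0.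
  move=> y1; apply: g0; rewrite /norm2.
  have := sqr_ge0 y.1.1; have := sqr_ge0 y.1.2; have := sqr_ge0 y.2.
  by case/or3P: y1 => /eqP->; lra.
have line (y : R -> R3) (t : R) : (forall s, y s = y 0 + s *: v) ->
    is_derive t (1 : R) (g \o y) (dg (y t)).
  move=> yE; rewrite (_ : g \o y = fun s => g (y 0 + s *: v)).
    by apply: is_derive_line; rewrite -yE; exact: gdg.
  by apply/funext => s /=; rewrite [in LHS]yE.
have dirE : (forall y z s, (s, y, z) = (0, y, z) + s *: dir0 R) *
    (forall x z s, (x, s, z) = (x, 0, z) + s *: dir1 R) *
    (forall x y s, (x, y, s) = (x, y, 0) + s *: dir2 R).
  by split; [split|] => a b s; apply/pair_equal_spec; split;
    [apply/pair_equal_spec; split| |apply/pair_equal_spec; split| |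
     apply/pair_equal_spec; split|]; rewrite /= -?[(_ *: _)%R]/(_ * _) ?mulr0 ?mulr1 ?addr0 ?add0r.
move: vdir; rewrite !inE => /or3P[]/eqP vE; rewrite {}vE in line.
- apply: box_integral0_fst => // z; apply: integral_square0_fst => [|y].
    exact: continuous_pair1.
  apply: (@integral_side_derive _ (fun x => g (x, y, z))).
  + by apply: (@continuous_pair1 _ _ _ (fun p => dg (p, z))); exact: continuous_pair1.
  + by move=> t; apply: (line (fun s => (s, y, z))) => s; exact: dirE.1.1.
  + by apply: far; rewrite /= sqrrN expr1n eqxx.
  + by apply: far; rewrite /= expr1n eqxx.
- apply: box_integral0_fst => // z; apply: integral_square0_snd => [|x].
    exact: continuous_pair1.
  apply: (@integral_side_derive _ (fun y => g (x, y, z))).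
  + by apply: (@continuous_pair2 _ _ _ (fun p => dg (p, z))); exact: continuous_pair1.
  + by move=> t; apply: (line (fun s => (x, s, z))) => s; exact: dirE.1.2.
  + by apply: far; rewrite /= sqrrN expr1n eqxx orbT.
  + by apply: far; rewrite /= expr1n eqxx orbT.
- apply: box_integral0_snd => // -[x y].
  apply: (@integral_side_derive _ (fun z => g (x, y, z))).
  + exact: continuous_pair2.
  + by move=> t; apply: (line (fun s => (x, y, s))) => s; exact: dirE.2.
  + by apply: far; rewrite /= sqrrN expr1n eqxx !orbT.
  + by apply: far; rewrite /= expr1n eqxx !orbT.
Qed.

End Divergence.

(** * Euclidean geometry of the ball *)

Section Geometry.
Context {R : realType}.
Local Notation R3 := (R * R * R)%type.
Implicit Types x y v : R3.

Definition dot x y : R := x.1.1 * y.1.1 + x.1.2 * y.1.2 + x.2 * y.2.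

Lemma norm2_ge0 x : 0 <= norm2 x.
Proof. by rewrite !addr_ge0// sqr_ge0. Qed.

Lemma enorm3_ge0 x : 0 <= enorm3 x.
Proof. exact: sqrtr_ge0. Qed.

Lemma enorm3_sqr x : enorm3 x ^+ 2 = norm2 x.
Proof. by rewrite sqr_sqrtr// norm2_ge0. Qed.

Lemma norm2D x y : norm2 (x + y) = norm2 x + 2 * dot x y + norm2 y.
Proof. by rewrite /norm2 /dot /=; ring. Qed.

Lemma norm2Z (a : R) x : norm2 (a *: x) = a ^+ 2 * norm2 x.
Proof.
rewrite [LHS](_ : _ = (a * x.1.1) ^+ 2 + (a * x.1.2) ^+ 2 + (a * x.2) ^+ 2)//.
by rewrite /norm2; ring.
Qed.

Lemma dotZl (a : R) x y : dot (a *: x) y = a * dot x y.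
Proof.
rewrite [LHS](_ : _ = (a * x.1.1) * y.1.1 + (a * x.1.2) * y.1.2 + (a * x.2) * y.2)//.
by rewrite /dot; ring.
Qed.

Lemma enorm3_le x (a : R) : 0 <= a -> (enorm3 x <= a) = (norm2 x <= a ^+ 2).
Proof. by move=> a0; rewrite -enorm3_sqr ler_sqr// nnegrE enorm3_ge0. Qed.

Lemma enorm3_lt x (a : R) : 0 <= a -> (enorm3 x < a) = (norm2 x < a ^+ 2).
Proof. by move=> a0; rewrite -enorm3_sqr ltr_sqr// nnegrE enorm3_ge0. Qed.

Lemma enorm3Z (a : R) x : 0 <= a -> enorm3 (a *: x) = a * enorm3 x.
Proof.
move=> a0; apply/eqP; rewrite -(eqrXn2 (n := 2))// ?enorm3_ge0//.
  by rewrite exprMn !enorm3_sqr norm2Z.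
by rewrite mulr_ge0// enorm3_ge0.
Qed.

Lemma dot_le x y : dot x y <= enorm3 x * enorm3 y.
Proof.
have [d0|d0] := leP (dot x y) 0.
  by rewrite (le_trans d0)// mulr_ge0 ?enorm3_ge0.
rewrite -ler_sqr ?nnegrE ?(ltW d0) ?mulr_ge0 ?enorm3_ge0//.
rewrite exprMn !enorm3_sqr /dot /norm2 -subr_ge0.
rewrite (_ : _ - _ = (x.1.1 * y.1.2 - x.1.2 * y.1.1) ^+ 2 +
  (x.1.1 * y.2 - x.2 * y.1.1) ^+ 2 + (x.1.2 * y.2 - x.2 * y.1.2) ^+ 2); last ring.
by rewrite !addr_ge0 ?sqr_ge0.
Qed.

Lemma ler_enorm3D x y : enorm3 (x + y) <= enorm3 x + enorm3 y.
Proof.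
rewrite enorm3_le ?addr_ge0 ?enorm3_ge0// norm2D sqrrD !enorm3_sqr.
by rewrite lerD2r lerD2l -[leRHS]mulr_natl ler_pM2l// dot_le.
Qed.

Lemma continuous_norm2 : continuous (@norm2 R).
Proof.
move=> y; rewrite /norm2.
apply: cvgD; [apply: cvgD|]; apply: (@cvg_comp _ _ _ _ (fun t : R => t ^+ 2));
  try exact: exprn_continuous.
- by apply: cvg_comp; [exact: cvg_fst|exact: cvg_fst].
- by apply: cvg_comp; [exact: cvg_fst|exact: cvg_snd].
- exact: cvg_snd.
Qed.

Lemma norm2_le1_box x : norm2 x <= 1 -> box x.
Proof.
rewrite /norm2 => x1.
have := sqr_ge0 x.1.1; have := sqr_ge0 x.1.2; have := sqr_ge0 x.2.
have side1 (t : R) : t ^+ 2 <= 1 -> -1 <= t <= 1.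
  by rewrite -ler_norml -real_normK ?num_real// expr_le1.
by move=> ? ? ?; split; [split|]; rewrite /= in_itv/=; apply: side1; lra.
Qed.

Lemma compact_ball3 (r : R) : r < 1 -> compact [set x : R3 | enorm3 x <= r].
Proof.
move=> r1.
have [r0|r0] := ltP r 0.
  rewrite (_ : [set _ | _] = set0); first exact: compact0.
  apply/seteqP; split=> x //= xr.
  by have := lt_le_trans r0 (enorm3_ge0 x); rewrite ltNge xr.
apply: (subclosed_compact _ (@compact_box R)).
  rewrite (_ : [set _ | _] = norm2 @^-1` [set t : R | t <= r ^+ 2]).
    by apply: preimage_closed => [x _|]; [exact: continuous_norm2|exact: closed_le].
  by apply/seteqP; split => x /=; rewrite enorm3_le.
move=> x /=; rewrite enorm3_le// => xr; apply: norm2_le1_box.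
by rewrite (le_trans xr)// expr_le1// ltW.
Qed.

Lemma dotC x y : dot x y = dot y x.
Proof. by rewrite /dot; ring. Qed.

Lemma dotDr x y v : dot x (y + v) = dot x y + dot x v.
Proof. by rewrite /dot /=; ring. Qed.

Lemma dot0E y : dot (dir0 R) y = y.1.1.
Proof. by rewrite /dot /=; ring. Qed.

Lemma dot1E y : dot (dir1 R) y = y.1.2.
Proof. by rewrite /dot /=; ring. Qed.

Lemma dot2E y : dot (dir2 R) y = y.2.
Proof. by rewrite /dot /=; ring. Qed.

Lemma dotxx x : dot x x = norm2 x.
Proof. by rewrite /dot /norm2; ring. Qed.

Lemma continuous_dot v : continuous (dot v).
Proof.
move=> y; rewrite /dot.
apply: cvgD; [apply: cvgD|]; apply: cvgM; try exact: cvg_cst.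
- by apply: cvg_comp; [exact: cvg_fst|exact: cvg_fst].
- by apply: cvg_comp; [exact: cvg_fst|exact: cvg_snd].
- exact: cvg_snd.
Qed.

Lemma norm_dot_le v y : `|dot v y| <= enorm3 v * enorm3 y.
Proof.
rewrite ler_norml dot_le andbT lerNl.
have -> : - dot v y = dot (- v) y by rewrite /dot /=; ring.
rewrite (le_trans (dot_le _ _))// /enorm3 /= !sqrrN//.
Qed.

Lemma enorm3_le1 y : norm2 y <= 1 -> enorm3 y <= 1.
Proof. by move=> y1; rewrite enorm3_le// expr1n. Qed.

Lemma ball3_0 : ball3 (0 : R3).
Proof. by rewrite /ball3 /= -(scale0r (0 : R3)) enorm3Z// mul0r. Qed.

Lemma ball3_affine (c : R3) (rho : R) y : 0 <= rho -> enorm3 c + rho < 1 -> norm2 y <= 1 ->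
  ball3 (c + rho *: y).
Proof.
move=> r0 cr y1; rewrite /ball3 /= (le_lt_trans (ler_enorm3D _ _))//.
by rewrite (le_lt_trans _ cr)// lerD2l enorm3Z// ler_piMr// enorm3_le1.
Qed.

Lemma near_ball3 (x : R3) : ball3 x -> \forall y \near x, ball3 y.
Proof.
have FF : Filter (nbhs x) by exact: nbhs_filter.
rewrite /ball3 /= enorm3_lt// expr1n => x1.
have cn : norm2 z @[z --> x] --> norm2 x by exact: continuous_norm2.
apply: (@filterS _ _ FF _ _ _ (cvgr_lt (norm2 x) cn 1 x1)) => y y1 /=.
by rewrite enorm3_lt// expr1n.
Qed.

End Geometry.

(** * Derivatives under the integral, gradients and radial kernels *)

Section DerivativeUnderIntegral.
Context {R : realType}.
Local Notation R3 := (R * R * R)%type.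

(** Dominated differentiation with a constant bound, which is integrable because
    the box has finite volume. *)
Lemma is_derive_box_integral (h dh : R -> R3 -> R) (a u v M : R) :
  u < a < v -> 0 <= M ->
  (forall s, u < s < v -> continuous (h s)) ->
  (forall s y, u < s < v -> is_derive s (1 : R) (h ^~ y) (dh s y)) ->
  (forall s y, u < s < v -> `|dh s y| <= M) ->
  is_derive a (1 : R) (fun s => box_integral (h s)) (box_integral (dh a)).
Proof.
move=> uav M0 ch hdh dhM.
have dhE s y : u < s < v -> partial1of2 h s y = dh s y.
  by move=> usv; rewrite partial1of2E; have ? := hdh s y usv; rewrite derive_val.
have Ia : `]u, v[%classic a by rewrite /= in_itv.
have inth s : `]u, v[%classic s ->
    ((@lebesgue2 R \x @lebesgue_measure R)%E).-integrable (@box R) (EFin \o h s).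
  by rewrite /= in_itv/= => usv; apply: integrable_box; exact: ch.
have derh s y : `]u, v[%classic s -> box y -> derivable (h ^~ y) s 1.
  by rewrite /= in_itv/= => usv _; have ? := hdh s y usv; exact: ex_derive.
have intM : ((@lebesgue2 R \x @lebesgue_measure R)%E).-integrable (@box R) (EFin \o cst M).
  by apply: integrable_box => y; exact: cvg_cst.
have ubM s y : `]u, v[%classic s -> box y -> `|partial1of2 h s y| <= M.
  by rewrite /= in_itv/= => usv _; rewrite dhE//; exact: dhM.
have M0' (y : R3) : 0 <= cst M y by [].
pose mu := (@lebesgue2 R \x @lebesgue_measure R)%E.
have mbox : measurable (@box R) by exact: measurable_box.
have D1 := @derivable_under_integral _ _ _ mu h _ mbox a u v Ia inth derh _ M0' intM ubM.
have D2 := @differentiation_under_integral _ _ _ mu h _ mbox a u v Ia inth derh _ M0' intM ubM.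
apply: DeriveDef; first exact: D1.
rewrite -derive1E [LHS]D2.
by apply: eq_Rintegral => y _; exact: dhE.
Qed.

End DerivativeUnderIntegral.

Section Gradient.
Context {R : realType}.
Local Notation R3 := (R * R * R)%type.
Implicit Types (f : R3 -> R) (x v : R3).

Definition grad f x : R3 := ('D_(dir0 R) f x, 'D_(dir1 R) f x, 'D_(dir2 R) f x).

Lemma is_derive_grad f x v : differentiable f x -> is_derive x v f (dot v (grad f x)).
Proof.
move=> df; apply: DeriveDef; first exact: diff_derivable.
rewrite /grad !deriveE// /dot/=.
have -> : v = v.1.1 *: dir0 R + v.1.2 *: dir1 R + v.2 *: dir2 R.
  case: v => -[a b] c.
  by apply/pair_equal_spec; split; [apply/pair_equal_spec; split|];
    rewrite /= -?[(_ *: _)%R]/(_ * _) ?mulr0 ?mulr1 ?addr0 ?add0r.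
by rewrite !linearD !linearZ /= -?[(_ *: _)%R]/(_ * _) ?mulr0 ?mulr1 ?addr0 ?add0r.
Qed.

End Gradient.

Section Cut.
Context {R : realType}.
Local Notation R3 := (R * R * R)%type.
Implicit Types p : {poly R}.

(** In terms of q = |y|^2, the unit ball is the region q < 1. *)
Definition disc_cut p (q : R) : R := if q < 1 then p.[q] else 0.

Lemma continuous_disc_cut p : p.[1] = 0 -> continuous (disc_cut p).
Proof.
move=> p1; rewrite (_ : disc_cut p = fun q => p.[Num.min q 1]); last first.
  by apply/funext => q; rewrite /disc_cut /Num.min; case: ltP.
move=> q; apply: (@continuous_comp _ _ _ (fun q : R => Num.min q 1) (horner p)).
  by apply: continuous_min; [exact: cvg_id|exact: cvg_cst].
by apply/differentiable_continuous/derivable1_diffP; exact: derivable_horner.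
Qed.

(** A double root at 1 makes the two pieces match to first order. At q = 1 the
    difference quotient of the cut polynomial is either that of p, which tends
    to p'(1) = 0, or zero. *)
Lemma is_derive_disc_cut p (q : R) : p.[1] = 0 -> p^`().[1] = 0 ->
  is_derive q (1 : R) (disc_cut p) (disc_cut p^`() q).
Proof.
move=> p1 dp1; have [q1|q1|->] := ltgtP q 1.
- rewrite {2}/disc_cut q1; apply: (@near_eq_is_derive _ _ _ (horner p)).
  by near=> t; rewrite /disc_cut ifT//; near: t; exact: lt_nbhsl.
- rewrite {2}/disc_cut ltNge (ltW q1)/=; apply: (@near_eq_is_derive _ _ _ (cst 0)).
  near=> t; rewrite /disc_cut ifF//; apply/negbTE; rewrite -leNgt ltW//; near: t.
  exact: lt_nbhsr.
- have := is_derive_poly p 1; rewrite dp1 is_derive1_caratheodory => -[g [pg cg g1]].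
  apply/is_derive1_caratheodory; exists (fun z => if z < 1 then g z else 0); split.
  + move=> z; rewrite /disc_cut ltxx subr0; case: ifP => _; last by rewrite mul0r.
    by rewrite -pg p1 subr0.
  + rewrite /prop_for /continuous_at ltxx; apply/cvgrPdist_lt => e e0.
    move: cg; rewrite /prop_for /continuous_at g1 => /cvgrPdist_lt/(_ e e0) cg.
    near=> z; rewrite sub0r normrN; case: ifP => _; last by rewrite normr0.
    by rewrite -normrN -sub0r; near: z.
  + by rewrite /disc_cut !ltxx.
Unshelve. all: by end_near. Qed.

Definition radial p (y : R3) : R := disc_cut p (norm2 y).

Lemma continuous_radial p : p.[1] = 0 -> continuous (radial p).
Proof.
move=> p1 y; apply: continuous_comp; [exact: continuous_norm2|exact: continuous_disc_cut].
Qed.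

Lemma radial_eq0 p y : 1 <= norm2 y -> radial p y = 0.
Proof. by rewrite /radial /disc_cut ltNge => ->. Qed.

Lemma is_derive_radial p (y v : R3) : p.[1] = 0 -> p^`().[1] = 0 ->
  is_derive y v (radial p) (2 * dot y v * radial p^`() y).
Proof.
move=> p1 dp1; apply: line_is_derive.
have dn : is_derive 0 (1 : R) (fun s : R => norm2 (y + s *: v)) (2 * dot y v).
  pose P := (norm2 y)%:P + (2 * dot y v)%:P * 'X + (norm2 v)%:P * 'X^2.
  rewrite (_ : (fun _ => _) = horner P).
    have := is_derive_poly P 0; rewrite /P !(derivD, derivM, derivC, derivX).
    by rewrite !hornerE /=; congr is_derive; ring.
  apply/funext => s; rewrite norm2D norm2Z /P !hornerE /dot /= -?[(_ *: _)%R]/(_ * _).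
  ring.
rewrite mulrC; apply: (@is_derive1_comp _ (disc_cut p) (fun s : R => norm2 (y + s *: v))).
have := is_derive_disc_cut (norm2 y) p1 dp1; rewrite /radial.
by rewrite scale0r addr0.
Qed.

End Cut.

(** * Products with a kernel supported in the unit ball *)

Section Cutoff.
Context {R : realType}.
Local Notation R3 := (R * R * R)%type.
Implicit Types (h k : R3 -> R) (v y : R3).

Lemma near_outside y : 1 < norm2 y -> \forall z \near y, 1 <= norm2 z.
Proof.
move=> y1.
have cn : norm2 z @[z --> y] --> norm2 y by exact: continuous_norm2.
have FF : Filter (nbhs y) by exact: nbhs_filter.
have H := cvgr_gt (norm2 y) cn 1 y1.
exact: (@filterS _ _ FF _ _ (fun z => @ltW _ _ _ _) (H FF)).
Qed.

(** Here h stands for a function known only on the ball where f is defined. The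
    product with a kernel that vanishes for |y| >= 1 is defined and continuous on
    all of R^3 whatever the values of h outside. *)
Lemma continuous_cutoff h k :
  (forall y, norm2 y <= 1 -> {for y, continuous h}) -> continuous k ->
  (forall y, 1 <= norm2 y -> k y = 0) -> continuous (fun y => h y * k y).
Proof.
move=> ch ck k0 y; have [y1|y1] := leP (norm2 y) 1.
  by apply: cvgM; [exact: ch|exact: ck].
rewrite /continuous_at (k0 _ (ltW y1)) mulr0.
apply: cvg_near_cst; near=> z; rewrite k0 ?mulr0//; near: z.
exact: near_outside.
Unshelve. all: by end_near. Qed.

Lemma is_derive_cutoff v h dh k dk y :
  (norm2 y <= 1 -> is_derive y v h (dh y)) -> is_derive y v k (dk y) ->
  (forall y, 1 <= norm2 y -> k y = 0) ->
  is_derive y v (fun z => h z * k z) (dh y * k y + h y * dk y).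
Proof.
move=> hdh kdk k0; have [y1|y1] := leP (norm2 y) 1.
  have {}hdh := hdh y1.
  have -> : dh y * k y + h y * dk y = h y *: dk y + k y *: dh y.
    by rewrite addrC [dh y * _]mulrC.
  exact: is_deriveM.
have kn : \forall z \near y, 0 = k z.
  by near=> z; rewrite k0//; near: z; exact: near_outside.
have dk0 : dk y = 0.
  rewrite -[LHS](@derive_val _ _ _ _ _ _ _ kdk).
  have /near_eq_is_derive/(_ (is_derive_cst 0 y v)) : \near y, cst 0 y = k y by [].
  by move=> ?; rewrite derive_val.
rewrite (k0 _ (ltW y1)) dk0 !mulr0 addr0.
apply: (@near_eq_is_derive _ _ _ (cst 0)).
by near=> z; rewrite -(near kn z)//= mulr0.
Unshelve. all: by end_near. Qed.

Lemma box_integral_by_parts v h dh k dk :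
  v \in [:: dir0 R; dir1 R; dir2 R] ->
  (forall y, norm2 y <= 1 -> is_derive y v h (dh y)) ->
  (forall y, norm2 y <= 1 -> {for y, continuous h}) ->
  (forall y, norm2 y <= 1 -> {for y, continuous dh}) ->
  (forall y, is_derive y v k (dk y)) -> continuous k -> continuous dk ->
  (forall y, 1 <= norm2 y -> k y = 0) -> (forall y, 1 <= norm2 y -> dk y = 0) ->
  box_integral (fun y => dh y * k y) = - box_integral (fun y => h y * dk y).
Proof.
move=> vdir hdh ch cdh kdk ck cdk k0 dk0; apply/eqP; rewrite -addr_eq0; apply/eqP.
rewrite -box_integralD; [|exact: continuous_cutoff..].
apply: (@box_integral_partial _ v (fun y => h y * k y)) => //.
- by move=> y; apply: cvgD; exact: continuous_cutoff.
- by move=> y; apply: is_derive_cutoff => // ?; exact: hdh.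
- by move=> y y1; rewrite k0// mulr0.
Qed.

End Cutoff.

Section Pullback.
Context {R : realType}.
Local Notation R3 := (R * R * R)%type.
Implicit Types (f : R3 -> R) (v y c e : R3).

Definition C1_ball f := forall x, ball3 x ->
  differentiable f x /\ {for x, continuous (grad f)}.

(** The gradient is continuous on a closed ball of radius less than 1, which is
    compact. *)
Lemma grad_bounded f (r : R) : r < 1 -> C1_ball f ->
  exists2 M, 0 <= M & forall x v, enorm3 x <= r -> `|dot v (grad f x)| <= enorm3 v * M.
Proof.
move=> r1 fC1.
have [|M M0 gM] := @compact_bounded_fun _ _ _ (fun x => norm2 (grad f x)) (compact_ball3 r1).
  move=> x; rewrite inE /= => xr.
  apply: continuous_comp; last exact: continuous_norm2.
  by have [] := fC1 x (le_lt_trans xr r1).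
exists (M + 1); first by rewrite addr_ge0.
move=> x v xr; rewrite (le_trans (norm_dot_le _ _))// ler_wpM2l ?enorm3_ge0//.
rewrite enorm3_le ?addr_ge0//.
have := gM x xr; rewrite ger0_norm ?norm2_ge0//; nra.
Qed.

Section AffinePullback.
Variables (f : R3 -> R) (c : R3) (rho : R) (y : R3).
Hypotheses (fC1 : C1_ball f) (cy1 : ball3 (c + rho *: y)).

Let continuous_affine : continuous (fun y : R3 => c + rho *: y).
Proof. by move=> z; apply: cvgD; [exact: cvg_cst|apply: cvgZ; [exact: cvg_cst|exact: cvg_id]]. Qed.

Lemma continuous_pullback :
  {for y, continuous (fun y => f (c + rho *: y))}.
Proof.
apply: continuous_comp; first exact: continuous_affine.
have [df _] := fC1 cy1.
exact: differentiable_continuous.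
Qed.

Lemma continuous_grad_pullback v :
  {for y, continuous (fun y => dot v (grad f (c + rho *: y)))}.
Proof.
apply: (@continuous_comp _ _ _ (fun y => grad f (c + rho *: y)) (dot v)).
  apply: continuous_comp; first exact: continuous_affine.
  by have [_] := fC1 cy1.
exact: continuous_dot.
Qed.

Lemma is_derive_pullback v :
  is_derive y v (fun y => f (c + rho *: y)) (rho * dot v (grad f (c + rho *: y))).
Proof.
apply: line_is_derive.
have [df _] := fC1 cy1.
rewrite (_ : (fun _ => _) = fun s => f ((c + rho *: y) + s *: (rho *: v))); last first.
  by apply/funext => s; rewrite scalerDr addrA !scalerA [s * rho]mulrC.
apply: is_derive_line; rewrite scale0r addr0.
by rewrite -dotZl; exact: is_derive_grad.
Qed.

End AffinePullback.

End Pullback.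

(** * Moving averages and the divergence of a radial field *)

Section MeanValue.
Context {R : realType}.
Local Notation R3 := (R * R * R)%type.
Local Notation dirs := [:: dir0 R; dir1 R; dir2 R].
Implicit Types (f k : R3 -> R) (v w y c e : R3) (p : {poly R}).

Lemma is_derive_dot w y v : is_derive y v (dot w) (dot w v).
Proof.
apply: line_is_derive; pose P := (dot w y)%:P + (dot w v)%:P * 'X.
rewrite (_ : (fun _ => _) = horner P).
  have := is_derive_poly P 0; rewrite /P !(derivD, derivM, derivC, derivX).
  by rewrite !hornerE /=; congr is_derive; ring.
apply/funext => s; rewrite dotDr [dot w (_ *: _)]dotC dotZl /P !hornerE.
by rewrite [dot v w]dotC mulrC.
Qed.

(** The path t |-> a y + t w y covers the two motions needed: scaling the ball,
    where a is constant and w y = y, and translating it, where w is constant. *)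
Lemma is_derive_box_integral_path f k (a w : R3 -> R3) (s u v r : R) (M : R) :
  u < s < v -> r < 1 -> C1_ball f -> continuous k ->
  (forall y, 1 <= norm2 y -> k y = 0) ->
  (forall t, continuous (fun y => a y + t *: w y)) ->
  (forall y, norm2 y <= 1 -> enorm3 (w y) <= M) ->
  (forall t y, u < t < v -> norm2 y <= 1 -> enorm3 (a y + t *: w y) <= r) ->
  is_derive s (1 : R) (fun t => box_integral (fun y => f (a y + t *: w y) * k y))
    (box_integral (fun y => dot (w y) (grad f (a y + s *: w y)) * k y)).
Proof.
move=> usv r1 fC1 ck k0 caw wM awr.
have [Mf Mf0 fMf] := grad_bounded r1 fC1.
have [|Mk Mk0 kMk] := @compact_bounded_fun _ _ _ k (@compact_box R).
  by move=> y _; exact: ck.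
have ball_aw t y : u < t < v -> norm2 y <= 1 -> ball3 (a y + t *: w y).
  by move=> utv y1; rewrite /ball3 /= (le_lt_trans (awr _ _ utv y1)).
apply: (@is_derive_box_integral _ (fun t y => f (a y + t *: w y) * k y)
  (fun t y => dot (w y) (grad f (a y + t *: w y)) * k y) s u v (`|M| * Mf * Mk)) => //.
- by rewrite !mulr_ge0.
- move=> t utv; apply: continuous_cutoff => // y y1.
  apply: continuous_comp; first exact: caw.
  have [df _] := fC1 _ (ball_aw t y utv y1).
  exact: differentiable_continuous.
- move=> t y utv; have [y1|y1] := leP (norm2 y) 1; last first.
    by rewrite (k0 _ (ltW y1)) mulr0; under eq_fun do rewrite mulr0; exact: is_derive_cst.
  have D : is_derive t (1 : R) (fun t => f (a y + t *: w y))
      (dot (w y) (grad f (a y + t *: w y))).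
    by apply/is_derive_line/is_derive_grad; have [] := fC1 _ (ball_aw t y utv y1).
  have := is_deriveM D (is_derive_cst (k y) t (1 : R)).
  by rewrite scaler0 add0r [_ *: _]mulrC.
- move=> t y utv; rewrite normrM; have [y1|y1] := leP (norm2 y) 1; last first.
    by rewrite (k0 _ (ltW y1)) normr0 mulr0 !mulr_ge0.
  apply: ler_pM => //; last by apply: kMk; exact: norm2_le1_box.
  rewrite (le_trans (fMf _ _ (awr _ _ utv y1)))// ler_wpM2r//.
  by rewrite (le_trans (wM _ y1))// ler_norm.
Qed.

Lemma is_derive_dot_radial p w y v : p.[1] = 0 -> p^`().[1] = 0 ->
  is_derive y v (fun y => dot w y * radial p y)
    (dot w v * radial p y + dot w y * (2 * dot y v * radial p^`() y)).
Proof.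
move=> p1 dp1.
have -> : dot w v * radial p y + dot w y * (2 * dot y v * radial p^`() y) =
    dot w y *: (2 * dot y v * radial p^`() y) + radial p y *: dot w v.
  by rewrite addrC [dot w v * _]mulrC.
by apply: is_deriveM; [exact: is_derive_dot|exact: is_derive_radial].
Qed.

Lemma continuous_dot_radial_derive p w v : p.[1] = 0 -> p^`().[1] = 0 ->
  continuous (fun y => dot w v * radial p y + dot w y * (2 * dot y v * radial p^`() y)).
Proof.
move=> p1 dp1 y; apply: cvgD; apply: cvgM.
- exact: cvg_cst.
- exact: continuous_radial.
- exact: continuous_dot.
- apply: cvgM; last exact: continuous_radial.
  apply: cvgM; first exact: cvg_cst.
  under eq_fun do rewrite dotC.
  by rewrite dotC; exact: continuous_dot.
Qed.

(** This is the integral of div (y p(|y|^2)) = 3 p + 2 |y|^2 p'. It relates the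
    integrals of different kernels without evaluating any of them. *)
Lemma radial_divergence p : p.[1] = 0 -> p^`().[1] = 0 ->
  3 * box_integral (radial p) + 2 * box_integral (fun y => norm2 y * radial p^`() y) = 0.
Proof.
move=> p1 dp1; pose E v y := dot v v * radial p y + dot v y * (2 * dot y v * radial p^`() y).
have cE v : continuous (E v) by exact: continuous_dot_radial_derive.
have E0 v : v \in dirs -> box_integral (fun y => E v y) = 0.
  move=> vd; apply: (@box_integral_partial _ v (fun y => dot v y * radial p y)) => //.
    by move=> y; exact: is_derive_dot_radial.
  by move=> y y1; rewrite radial_eq0// mulr0.
rewrite -box_integralZ; last exact: continuous_radial.
have cN : continuous (fun y => norm2 y * radial p^`() y).
  by move=> y; apply: cvgM; [exact: continuous_norm2|exact: continuous_radial].
rewrite -box_integralZ// -box_integralD; last 2 first.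
- by move=> y; apply: cvgM; [exact: cvg_cst|exact: continuous_radial].
- by move=> y; apply: cvgM; [exact: cvg_cst|exact: cN].
rewrite (_ : (fun y => _) = fun y => E (dir0 R) y + E (dir1 R) y + E (dir2 R) y).
  have c01 : continuous (fun y => E (dir0 R) y + E (dir1 R) y).
    by move=> y; apply: cvgD; exact: cE.
  rewrite (box_integralD c01 (cE (dir2 R))) (box_integralD (cE (dir0 R)) (cE (dir1 R))).
  by rewrite !E0 ?addr0// !inE eqxx ?orbT.
by apply/funext => y; rewrite /E /norm2 /dot /=; ring.
Qed.

End MeanValue.

(** * The mean value property *)

Section Riesz.
Context {R : realType}.
Local Notation R3 := (R * R * R)%type.
Local Notation dirs := [:: dir0 R; dir1 R; dir2 R].
Implicit Types (f k : R3 -> R) (v w y c e : R3) (p : {poly R}).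

Section ByParts.
Variables (f : R3 -> R) (c : R3) (s : R) (p : {poly R}).
Hypotheses (fC1 : C1_ball f) (s0 : 0 < s) (cs1 : enorm3 c + s < 1).
Hypotheses (p1 : p.[1] = 0) (dp1 : p^`().[1] = 0).

Let cs y : norm2 y <= 1 -> ball3 (c + s *: y).
Proof. by apply: ball3_affine => //; exact: ltW. Qed.

Lemma continuous_grad_kernel v w :
  continuous (fun y => dot v (grad f (c + s *: y)) * (dot w y * radial p y)).
Proof.
apply: continuous_cutoff.
- by move=> y y1; apply: continuous_grad_pullback => //; exact: cs.
- by move=> y; apply: cvgM; [exact: continuous_dot|exact: continuous_radial].
- by move=> y y1; rewrite radial_eq0// mulr0.
Qed.

Lemma box_integral_grad_kernel v w : v \in dirs ->
  s * box_integral (fun y => dot v (grad f (c + s *: y)) * (dot w y * radial p y)) =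
  - box_integral (fun y => f (c + s *: y) *
      (dot w v * radial p y + dot w y * (2 * dot y v * radial p^`() y))).
Proof.
move=> vd; rewrite -box_integralZ; last exact: continuous_grad_kernel.
under eq_fun do rewrite mulrA.
apply: (box_integral_by_parts (v := v)) => //.
- by move=> y y1; apply: is_derive_pullback => //; exact: cs.
- by move=> y y1; apply: continuous_pullback => //; exact: cs.
- move=> y y1; apply: cvgM; first exact: cvg_cst.
  by apply: continuous_grad_pullback => //; exact: cs.
- by move=> y; exact: is_derive_dot_radial.
- by move=> y; apply: cvgM; [exact: continuous_dot|exact: continuous_radial].
- exact: continuous_dot_radial_derive.
- by move=> y y1; rewrite radial_eq0// mulr0.
- by move=> y y1; rewrite !radial_eq0// !mulr0 addr0.
Qed.

(** Integrating by parts moves the derivative along v to (w . y) p(|y|^2). The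
    result, (w . v) p + 2 (w . y) (v . y) p', is symmetric in v and w. *)
Lemma box_integral_grad_swap v w : v \in dirs -> w \in dirs ->
  box_integral (fun y => dot v (grad f (c + s *: y)) * (dot w y * radial p y)) =
  box_integral (fun y => dot w (grad f (c + s *: y)) * (dot v y * radial p y)).
Proof.
move=> vd wd; apply: (mulfI (lt0r_neq0 s0)); rewrite !box_integral_grad_kernel//.
congr (- box_integral _); apply/funext => y.
by rewrite (dotC w v) (dotC w y) (dotC v y); ring.
Qed.

End ByParts.

(** The equations div (F0, F1, F2) = 0 and d_i F0 = d_0 F_i for i = 1, 2. When
    the functions are twice differentiable they make F0 harmonic, but they
    involve first derivatives only. *)
Definition riesz (F0 F1 F2 : R3 -> R) :=
  [/\ C1_ball F0, C1_ball F1, C1_ball F2 &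
   forall x, ball3 x ->
    [/\ dot (dir1 R) (grad F0 x) = dot (dir0 R) (grad F1 x),
        dot (dir2 R) (grad F0 x) = dot (dir0 R) (grad F2 x) &
        dot (dir0 R) (grad F0 x) + dot (dir1 R) (grad F1 x) + dot (dir2 R) (grad F2 x) = 0]].

Lemma riesz_flux_identity (g0 g1 g2 y : R3) (K : R) :
  dot (dir1 R) g0 = dot (dir0 R) g1 -> dot (dir2 R) g0 = dot (dir0 R) g2 ->
  dot (dir0 R) g0 + dot (dir1 R) g1 + dot (dir2 R) g2 = 0 ->
  dot y g0 * K =
  dot (dir0 R) g1 * (dot (dir1 R) y * K) - dot (dir1 R) g1 * (dot (dir0 R) y * K) +
  (dot (dir0 R) g2 * (dot (dir2 R) y * K) - dot (dir2 R) g2 * (dot (dir0 R) y * K)).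
Proof.
rewrite !(dot0E, dot1E, dot2E) => E1 E2 /eqP.
by rewrite -addrA addr_eq0 => /eqP E3; rewrite /dot E1 E2 E3; ring.
Qed.

Variables F0 F1 F2 : R3 -> R.
Hypothesis rF : riesz F0 F1 F2.

(** The field y p(|y|^2) is the gradient of a compactly supported function, and
    grad F0 is weakly divergence free; here this orthogonality is read off
    [riesz_flux_identity] and [box_integral_grad_swap]. *)
Lemma radial_flux0 c s p : 0 < s -> enorm3 c + s < 1 -> p.[1] = 0 -> p^`().[1] = 0 ->
  box_integral (fun y => dot y (grad F0 (c + s *: y)) * radial p y) = 0.
Proof.
have [C0 C1 C2 eqF] := rF; move=> s0 cs1 p1 dp1.
pose G F v w y := dot v (grad F (c + s *: y)) * (dot w y * radial p y).
have cG F v w : C1_ball F -> continuous (G F v w).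
  by move=> FC; exact: continuous_grad_kernel.
pose G1 y := G F1 (dir0 R) (dir1 R) y - G F1 (dir1 R) (dir0 R) y.
pose G2 y := G F2 (dir0 R) (dir2 R) y - G F2 (dir2 R) (dir0 R) y.
have d0 : dir0 R \in dirs by rewrite !inE eqxx.
have d1 : dir1 R \in dirs by rewrite !inE eqxx orbT.
have d2 : dir2 R \in dirs by rewrite !inE eqxx !orbT.
have cG1 : continuous G1 by move=> y; apply: cvgB; exact: cG.
have cG2 : continuous G2 by move=> y; apply: cvgB; exact: cG.
have I1 : box_integral G1 = 0.
  apply/eqP; rewrite (box_integralB (cG _ _ _ C1) (cG _ _ _ C1)) subr_eq0; apply/eqP.
  exact: box_integral_grad_swap.
have I2 : box_integral G2 = 0.
  apply/eqP; rewrite (box_integralB (cG _ _ _ C2) (cG _ _ _ C2)) subr_eq0; apply/eqP.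
  exact: box_integral_grad_swap.
rewrite -[RHS](addr0 0) -[in X in _ = X + _]I1 -[in X in _ = _ + X]I2.
rewrite -box_integralD//; congr box_integral; apply/funext => y.
(* Outside the ball the equations say nothing, but the kernel vanishes. *)
have [y1|y1] := leP 1 (norm2 y).
  by rewrite /G1 /G2 /G (radial_eq0 _ y1) !mulr0 !subr0 addr0.
have [E1 E2 E3] := eqF _ (ball3_affine (ltW s0) cs1 (ltW y1)).
exact: riesz_flux_identity.
Qed.

(** The average over the ball of radius s has zero derivative in s by
    [radial_flux0], and for s = 0 it is a constant integrand. *)
Lemma radial_mean_value c (rho : R) p : 0 <= rho -> enorm3 c + rho < 1 ->
  p.[1] = 0 -> p^`().[1] = 0 ->
  box_integral (fun y => F0 (c + rho *: y) * radial p y) = F0 c * box_integral (radial p).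
Proof.
move=> rho0 crho p1 dp1; have [C0 C1 C2 eqF] := rF.
pose A s := box_integral (fun y => F0 (c + s *: y) * radial p y).
have A0 : A 0 = F0 c * box_integral (radial p).
  rewrite -box_integralZ; last exact: continuous_radial.
  by congr box_integral; apply/funext => y; rewrite scale0r addr0.
rewrite -A0 -/(A rho); have [->//|rho_gt0] := eqVneq rho 0.
have {}rho_gt0 : 0 < rho by rewrite lt0r rho_gt0.
(* Room beyond rho, so that A is differentiable on a neighborhood of [0, rho]. *)
pose eps := (1 - enorm3 c - rho) / 2.
have eps0 : 0 < eps by rewrite /eps; lra.
have dA s : - (rho + eps) < s < rho + eps -> is_derive s (1 : R) A
    (box_integral (fun y => dot y (grad F0 (c + s *: y)) * radial p y)).
  move=> sin.
  apply: (@is_derive_box_integral_path _ F0 (radial p) (cst c) id s _ _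
    (enorm3 c + (rho + eps)) 1 sin) => //.
  - by rewrite /eps; lra.
  - exact: continuous_radial.
  - by move=> y y1; rewrite radial_eq0.
  - by move=> t y; apply: cvgD; [exact: cvg_cst|apply: cvgZ; [exact: cvg_cst|exact: cvg_id]].
  - exact: enorm3_le1.
  - move=> t y /andP[t1 t2] y1; rewrite (le_trans (ler_enorm3D _ _))// lerD2l.
    rewrite enorm3_le ?addr_ge0 ?(ltW eps0)// norm2Z.
    have := norm2_ge0 y; nra.
have dA0 (s : R) : s \in `]0, rho[ -> is_derive s (1 : R) A 0.
  rewrite in_itv/= => /andP[s0 srho].
  rewrite -(@radial_flux0 c s p)//; last by rewrite (lt_trans _ crho)// ltrD2l.
  by apply: dA; apply/andP; split; lra.
have cA : {within `[0, rho], continuous A}.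
  apply: derivable_within_continuous => s; rewrite in_itv/= => /andP[s0 srho].
  have sin : - (rho + eps) < s < rho + eps by apply/andP; split; lra.
  have ? := dA s sin; exact: ex_derive.
have [xi _ /eqP] := @MVT _ A (cst 0) _ _ rho_gt0 dA0 cA.
by rewrite mul0r subr_eq0 => /eqP.
Qed.

End Riesz.

(** * A kernel concentrated near the unit sphere *)

(** Used to obtain the kernel whose radial derivative is the opposite of [shell],
    of which only the derivative and the value at 1 matter. *)
Lemma poly_primitive (F : numFieldType) (p : {poly F}) (a : F) :
  exists P : {poly F}, P^`() = p /\ P.[a] = 0.
Proof.
pose Q : {poly F} := \poly_(i < (size p).+1) (p`_i.-1 / i%:R).
have dQ : Q^`() = p.
  apply/polyP => i; rewrite coef_deriv coef_poly ltnS.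
  case: ltnP => ip; first by rewrite /= -[LHS]mulr_natr divfK// pnatr_eq0.
  by rewrite mul0rn nth_default.
exists (Q - Q.[a]%:P); split; first by rewrite derivB derivC subr0.
by rewrite !hornerE subrr.
Qed.

Section Kernel.
Context {R : realType}.
Local Notation R3 := (R * R * R)%type.

Local Notation mu1 := (@lebesgue_measure R).
Local Notation mu2 := (@lebesgue2 R).
Local Notation mu3 := (mu2 \x mu1)%E.

Let hE := (@hornerXn R, @horner_exp R, @hornerM R, @hornerD R, @hornerN R,
  @hornerX R, @hornerC R, @hornerMn R).
Let dE := (@derivXn R, @deriv_exp R, @derivM R, @derivD R, @derivN R, @derivX R,
  @derivC R).

(** As a function of q = |y|^2. The factor (1 - q)^2 makes the kernel continuously
    differentiable across the sphere, and q^8 moves its mass close to the sphere. *)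
Definition shell : {poly R} := 'X^8 * (1%:P - 'X) ^+ 2.

Lemma shell1 : shell.[1] = 0.
Proof. by rewrite /shell !hE; ring. Qed.

Lemma shell_deriv1 : shell^`().[1] = 0.
Proof. by rewrite /shell !dE !hE; ring. Qed.

Lemma radial_shell_ge0 (y : R3) : 0 <= radial shell y.
Proof.
rewrite /radial /disc_cut; have [y1|//] := ltP (norm2 y) 1.
rewrite /shell !hE; apply: mulr_ge0; [by rewrite exprn_ge0// norm2_ge0|exact: sqr_ge0].
Qed.

(** [radial_divergence] for q^8 (1 - q)^3: there 3 W + 2 q W' is equal to
    (19 - 25 q) q^8 (1 - q)^2. *)
Lemma shell_moment : 19 * box_integral (radial shell) =
  25 * box_integral (fun y : R3 => norm2 y * radial shell y).
Proof.
pose W : {poly R} := 'X^8 * (1%:P - 'X) ^+ 3.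
have W1 : W.[1] = 0 by rewrite /W !hE; ring.
have dW1 : W^`().[1] = 0 by rewrite /W !dE !hE; ring.
apply/eqP; rewrite -subr_eq0; apply/eqP; rewrite -(radial_divergence W1 dW1).
have cS : continuous (radial shell) by apply: continuous_radial; exact: shell1.
have cnS : continuous (fun y : R3 => norm2 y * radial shell y).
  by move=> y; apply: cvgM; [exact: continuous_norm2|exact: cS].
have cW : continuous (radial W) by exact: continuous_radial.
have cnW : continuous (fun y : R3 => norm2 y * radial W^`() y).
  by move=> y; apply: cvgM; [exact: continuous_norm2|exact: continuous_radial].
have cZ (a : R) (g : R3 -> R) : continuous g -> continuous (fun y => a * g y).
  by move=> cg y; apply: cvgM; [exact: cvg_cst|exact: cg].
rewrite -!box_integralZ//.
rewrite -(box_integralB (cZ _ _ cS) (cZ _ _ cnS)) -(box_integralD (cZ _ _ cW) (cZ _ _ cnW)).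
congr box_integral; apply/funext => y; rewrite /radial /disc_cut.
have [_|_] := ltP (norm2 y) 1; last by rewrite !mulr0 subr0 addr0.
rewrite /shell /W !dE !hE; ring.
Qed.

(** The kernel has a positive lower bound on the cube [1/4, 1/2]^3, where |y|^2
    lies between 3/16 and 3/4. *)
Lemma box_integral_shell_gt0 : 0 < box_integral (radial shell).
Proof.
pose I : set R := `[4^-1, 2^-1]%classic.
pose S : set R3 := (I `*` I) `*` I.
pose m : R := 16^-1 ^+ 8 * 4^-1 ^+ 2.
have shell_m y : S y -> m <= radial shell y.
  move=> [[/= y0 y1] y2]; move: y0 y1 y2; rewrite /I /= !in_itv/=.
  move=> /andP[a0 b0] /andP[a1 b1] /andP[a2 b2].
  have n1 : 16^-1 <= norm2 y by rewrite /norm2; nra.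
  have n2 : norm2 y <= 3 / 4 by rewrite /norm2; nra.
  rewrite /radial /disc_cut ifT; last lra.
  rewrite /shell !hE; apply: ler_pM; rewrite ?exprn_ge0//.
    by apply: lerXn2r; rewrite ?nnegrE// norm2_ge0.
  by apply: lerXn2r; rewrite ?nnegrE//; lra.
have m0 : 0 < m by rewrite /m; lra.
have mI : measurable I by exact: measurable_itv.
have mS : measurable S by do 2 apply: measurableX => //.
have lenI : mu1 I = 4^-1%:E.
  by rewrite /I lebesgue_measure_itv/= lte_fin ifT; [rewrite -EFinB; congr (_%:E)|]; lra.
have volS : mu3 S = (4^-1 * 4^-1 * 4^-1)%:E.
  have areaII : mu2 (I `*` I) = (4^-1 * 4^-1)%:E.
    by transitivity (mu1 I * mu1 I)%E; [exact: product_measure1E|rewrite lenI].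
  transitivity (mu2 (I `*` I) * mu1 I)%E; last by rewrite areaII lenI.
  by apply: product_measure1E => //; exact: measurableX.
have cS : continuous (radial shell) by apply: continuous_radial; exact: shell1.
have iS : mu3.-integrable box (EFin \o radial shell) by exact: integrable_box.
rewrite -lte_fin /box_integral /Rintegral fineK; last first.
  by apply: (@integrable_fin_num _ _ _ mu3 box); [exact: measurable_box|exact: iS].
apply: (@lt_le_trans _ _ (m%:E * mu3 S)%E).
  by rewrite volS -EFinM lte_fin !mulr_gt0// invr_gt0.
rewrite -integral_cst//.
apply: (@le_trans _ _ (\int[mu3]_(y in S) (radial shell y)%:E)%E).
  apply: ge0_le_integral => //.
  - by move=> y _; rewrite lee_fin ltW.
  - apply/measurable_EFinP; apply: measurable_funTS; exact: continuous3_measurable.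
have mbox : measurable (@box R) by exact: measurable_box.
apply: (@ge0_subset_integral _ _ _ mu3 S box mS mbox (EFin \o radial shell)).
- by apply/measurable_EFinP; apply: measurable_funTS; exact: continuous3_measurable.
- by move=> y _; rewrite lee_fin radial_shell_ge0.
- move=> y [[/= y0 y1] y2]; move: y0 y1 y2; rewrite /I /= !in_itv/=.
  move=> /andP[a0 b0] /andP[a1 b1] /andP[a2 b2].
  by split; [split|]; rewrite /= in_itv/=; apply/andP; split; lra.
Qed.

End Kernel.

(** * The gradient estimate for nonnegative solutions *)

Section GradientEstimate.
Context {R : realType}.
Local Notation R3 := (R * R * R)%type.
Local Notation dirs := [:: dir0 R; dir1 R; dir2 R].
Variables F0 F1 F2 : R3 -> R.
Hypothesis rF : riesz F0 F1 F2.

(** Translating the center in [radial_mean_value] and differentiating gives the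
    mean value property for derivatives of F0, without any second derivative. *)
Lemma radial_gradient_mean_value (c e : R3) (rho : R) (p : {poly R}) :
  0 <= rho -> enorm3 c + rho < 1 -> p.[1] = 0 -> p^`().[1] = 0 ->
  box_integral (fun y => dot e (grad F0 (c + rho *: y)) * radial p y) =
  dot e (grad F0 c) * box_integral (radial p).
Proof.
move=> rho0 crho p1 dp1; have [C0 _ _ _] := rF.
have e0 := enorm3_ge0 e.
have e1 : 0 < 1 + enorm3 e by lra.
(* For |t| < d the ball of radius rho around c + t e uses at most half of the
   distance left to the unit sphere; 1 + |e| avoids a case e = 0. *)
pose d := (1 - enorm3 c - rho) / (2 * (1 + enorm3 e)).
have d0 : 0 < d by rewrite divr_gt0//; lra.
have de : d * (1 + enorm3 e) = (1 - enorm3 c - rho) / 2.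
  by rewrite /d; field; rewrite gt_eqF.
have cr1 : enorm3 c + rho + d * enorm3 e < 1 by nra.
have norm_te (t : R) : - d < t < d -> enorm3 (t *: e) <= d * enorm3 e.
  move=> /andP[t1 t2]; rewrite enorm3_le; last by rewrite mulr_ge0// ltW.
  by rewrite norm2Z exprMn enorm3_sqr ler_wpM2r ?norm2_ge0//; nra.
have ind : - d < 0 < d by rewrite oppr_lt0 d0.
have D1 := @is_derive_box_integral_path _ F0 (radial p) (fun y => c + rho *: y)
  (cst e) 0 (- d) d _ (enorm3 e) ind cr1 C0 (continuous_radial p1)
  (fun y => @radial_eq0 _ p y).
have {}D1 := D1 _ (fun _ _ => lexx _) _.
have D2 : is_derive 0 (1 : R) (fun t => F0 (c + t *: e) * box_integral (radial p))
    (dot e (grad F0 c) * box_integral (radial p)).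
  have cB : ball3 c by rewrite /ball3 /=; lra.
  have D : is_derive 0 (1 : R) (fun t => F0 (c + t *: e)) (dot e (grad F0 c)).
    apply: is_derive_line; rewrite scale0r addr0; apply: is_derive_grad.
    by have [] := C0 c cB.
  have := is_deriveM D (is_derive_cst (box_integral (radial p)) 0 (1 : R)).
  by rewrite scaler0 add0r [_ *: _]mulrC.
have near_eq : \forall t \near (0 : R), F0 (c + t *: e) * box_integral (radial p) =
    box_integral (fun y => F0 (c + rho *: y + t *: cst e y) * radial p y).
  have near_d : \forall t \near (0 : R), `|t| < d by exact: nbhs0_lt.
  near=> t.
  have td : - d < t < d by rewrite -ltr_norml; exact: (near near_d t).
  rewrite -(@radial_mean_value _ _ _ _ rF (c + t *: e) rho)//.
    by congr box_integral; apply/funext => y; rewrite addrAC.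
  rewrite (le_lt_trans _ cr1)// addrAC lerD2r (le_trans (ler_enorm3D _ _))// lerD2l.
  exact: norm_te.
have [_ <-] := near_eq_is_derive near_eq D2.
have [||_ ->] := D1.
- move=> t y; apply: cvgD; last by apply: cvgZ; exact: cvg_cst.
  by apply: cvgD; [exact: cvg_cst|apply: cvgZ; [exact: cvg_cst|exact: cvg_id]].
- move=> t y td y1; rewrite (le_trans (ler_enorm3D _ _))//; apply: lerD; last exact: norm_te.
  rewrite (le_trans (ler_enorm3D _ _))// lerD2l enorm3Z// ler_piMr//.
  exact: enorm3_le1.
by congr box_integral; apply/funext => y; rewrite scale0r addr0.
Unshelve. all: by end_near. Qed.

Lemma box_integral_gradient_kernel (f : R3 -> R) (c e : R3) (rho : R) (K : {poly R}) :
  C1_ball f -> 0 <= rho -> enorm3 c + rho < 1 -> K.[1] = 0 -> K^`().[1] = 0 ->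
  rho * box_integral (fun y => dot e (grad f (c + rho *: y)) * radial K y) =
  - box_integral (fun y => f (c + rho *: y) * (2 * dot y e * radial K^`() y)).
Proof.
move=> fC1 rho0 crho K1 dK1.
have cs y : norm2 y <= 1 -> ball3 (c + rho *: y) by exact: ball3_affine.
pose A v y := dot v (grad f (c + rho *: y)) * radial K y.
pose B v y := f (c + rho *: y) * (2 * dot y v * radial K^`() y).
have ck v : continuous (fun y => 2 * dot y v * radial K^`() y).
  move=> y; apply: cvgM; last exact: continuous_radial.
  apply: cvgM; first exact: cvg_cst.
  under eq_fun do rewrite dotC.
  by rewrite dotC; exact: continuous_dot.
have cA v : continuous (A v).
  apply: continuous_cutoff; [|exact: continuous_radial|by move=> y; exact: radial_eq0].
  by move=> y y1; apply: continuous_grad_pullback => //; exact: cs.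
have cB v : continuous (B v).
  apply: continuous_cutoff => // [y y1|y y1]; last by rewrite radial_eq0// mulr0.
  by apply: continuous_pullback => //; exact: cs.
have AB v : v \in dirs -> rho * box_integral (A v) = - box_integral (B v).
  move=> vd; rewrite -box_integralZ//.
  rewrite (_ : (fun y => rho * A v y) = fun y =>
    (rho * dot v (grad f (c + rho *: y))) * radial K y); last first.
    by apply/funext => y; rewrite mulrA.
  apply: (box_integral_by_parts (v := v)) => //.
  - by move=> y y1; apply: is_derive_pullback => //; exact: cs.
  - by move=> y y1; apply: continuous_pullback => //; exact: cs.
  - move=> y y1; apply: cvgM; first exact: cvg_cst.
    by apply: continuous_grad_pullback => //; exact: cs.
  - by move=> y; exact: is_derive_radial.
  - exact: continuous_radial.
  - by move=> y; exact: radial_eq0.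
  - by move=> y y1; rewrite radial_eq0// mulr0.
have cZ (a : R) (g : R3 -> R) : continuous g -> continuous (fun y => a * g y).
  by move=> cg y; apply: cvgM; [exact: cvg_cst|exact: cg].
(* Linearity reduces the direction e to the three coordinate directions. *)
have sum3 (E : R3 -> R3 -> R) : (forall v, continuous (E v)) ->
    (forall y, E e y = e.1.1 * E (dir0 R) y + e.1.2 * E (dir1 R) y + e.2 * E (dir2 R) y) ->
    box_integral (E e) = e.1.1 * box_integral (E (dir0 R)) +
      e.1.2 * box_integral (E (dir1 R)) + e.2 * box_integral (E (dir2 R)).
  move=> cE /funext ->.
  have c01 : continuous (fun y => e.1.1 * E (dir0 R) y + e.1.2 * E (dir1 R) y).
    by move=> y; apply: cvgD; exact: cZ.
  rewrite (box_integralD c01 (cZ _ _ (cE _))) (box_integralD (cZ _ _ (cE _)) (cZ _ _ (cE _))).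
  by rewrite !box_integralZ.
rewrite -/(A e) -/(B e) (sum3 A cA) => [|y].
  rewrite (sum3 B cB) => [|y].
    rewrite !mulrDr !(mulrCA rho) !AB ?inE ?eqxx ?orbT//; ring.
  rewrite /B; move: (f _) (radial _ _) => u r.
  by rewrite /dot /=; ring.
rewrite /A; move: (grad _ _) (radial _ _) => g r.
by rewrite /dot /=; ring.
Qed.

(** Differentiating the mean value against K and integrating by parts leaves F0
    against (y . e) [shell]. Positivity of F0 allows y . e to be replaced by |e|,
    and the mean value property for [shell] brings back F0 c. The numbers come
    from 3 J(K) = 2 J(q shell) and 19 J(shell) = 25 J(q shell), where J is the
    integral. *)
Lemma gradient_estimate (c e : R3) (rho : R) :
  (forall x, ball3 x -> 0 <= F0 x) -> 0 <= rho -> enorm3 c + rho < 1 ->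
  19 * rho * dot e (grad F0 c) <= 75 * enorm3 e * F0 c.
Proof.
move=> F0_ge0 rho0 crho; have [C0 _ _ _] := rF.
have [K [dK K1]] := poly_primitive (- @shell R) 1.
have dK1 : K^`().[1] = 0 by rewrite dK hornerN shell1 oppr0.
have radial_dK y : radial K^`() y = - radial shell y.
  rewrite dK /radial /disc_cut; have [_|_] := ltP (norm2 y) 1; last by rewrite oppr0.
  by rewrite hornerN.
pose S := box_integral (@radial R shell).
have S0 : 0 < S by exact: box_integral_shell_gt0.
have cs y : norm2 y <= 1 -> ball3 (c + rho *: y) by exact: ball3_affine.
have shell_c : continuous (@radial R shell) by apply: continuous_radial; exact: shell1.
have JK : 75 * box_integral (radial K) = 38 * S.
  have := radial_divergence K1 dK1; have := @shell_moment R; rewrite -/S.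
  rewrite (_ : (fun y => norm2 y * radial K^`() y) = fun y => (-1) * (norm2 y * radial shell y)).
    rewrite box_integralZ; first lra.
    by move=> y; apply: cvgM; [exact: continuous_norm2|exact: shell_c].
  by apply/funext => y; rewrite radial_dK; ring.
have G := box_integral_gradient_kernel e C0 rho0 crho K1 dK1.
rewrite (radial_gradient_mean_value _ rho0 crho K1 dK1) in G.
have MV := radial_mean_value rF rho0 crho (@shell1 R) (@shell_deriv1 R).
have cF : continuous (fun y : R3 => F0 (c + rho *: y) * radial shell y).
  apply: continuous_cutoff => // [y y1|y y1]; last by rewrite radial_eq0.
  by apply: continuous_pullback => //; exact: cs.
have bound : - box_integral (fun y => F0 (c + rho *: y) * (2 * dot y e * radial K^`() y)) <=
    (2 * enorm3 e) * (F0 c * S).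
  rewrite -MV -box_integralZ//.
  pose H (y : R3) := 2 * dot e y * (F0 (c + rho *: y) * radial shell y).
  have cH : continuous H.
    move=> y; apply: cvgM; last exact: cF.
    by apply: cvgM; [exact: cvg_cst|exact: continuous_dot].
  rewrite (_ : (fun y : R3 => _ * (2 * _ * _)) = fun y => (-1) * H y); last first.
    by apply/funext => y; rewrite radial_dK dotC /H; ring.
  rewrite (box_integralZ (-1) cH) mulN1r opprK.
  apply: le_box_integral => //.
    by move=> y; apply: cvgM; [exact: cvg_cst|exact: cF].
  move=> y; have [y1|y1] := leP 1 (norm2 y); first by rewrite /H radial_eq0// !mulr0.
  apply: ler_wpM2r.
    by rewrite mulr_ge0 ?radial_shell_ge0// F0_ge0//; apply: cs; exact: ltW.
  rewrite ler_wpM2l// (le_trans (dot_le _ _))// ler_piMr ?enorm3_ge0//.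
  by apply: enorm3_le1; exact: ltW.
rewrite -(ler_pM2r S0).
rewrite -G in bound.
have : 75 * (rho * (dot e (grad F0 c) * box_integral (radial K))) <=
  75 * (2 * enorm3 e * (F0 c * S)) by rewrite ler_pM2l.
rewrite (_ : 75 * _ = rho * dot e (grad F0 c) * (75 * box_integral (radial K))); last ring.
rewrite JK; lra.
Qed.

End GradientEstimate.

(** * From the gradient estimate to the value at the center *)

Section PositiveHarmonic.
Context {R : realType}.
Local Notation R3 := (R * R * R)%type.
Variables F0 F1 F2 : R3 -> R.
Hypotheses (rF : riesz F0 F1 F2) (F0_ge0 : forall x, ball3 x -> 0 <= F0 x).

Lemma gradient_le (c e : R3) : ball3 c ->
  (1 - enorm3 c) * dot e (grad F0 c) <= 4 * enorm3 e * F0 c.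
Proof.
rewrite /ball3 /= => c1.
(* The radius 75/76 of the available one turns the constant 75/19 into 4. *)
have rho0 : 0 <= (75 / 76) * (1 - enorm3 c) by lra.
have crho : enorm3 c + (75 / 76) * (1 - enorm3 c) < 1 by lra.
have := gradient_estimate rF e F0_ge0 rho0 crho; lra.
Qed.

(** By [gradient_le], F0(sx) (1 - s|x|)^4 has nonpositive derivative in s. *)
Lemma harnack_upper (x : R3) : ball3 x -> F0 x * (1 - enorm3 x) ^+ 4 <= F0 0.
Proof.
move=> xB; have x1 : enorm3 x < 1 by [].
have [C0 _ _ _] := rF; have x0 := enorm3_ge0 x; set r := enorm3 x in x0 x1 *.
have sB (s : R) : 0 <= s <= 1 -> ball3 (s *: x).
  by move=> /andP[s0 s1]; rewrite /ball3 /= enorm3Z// -/r; nra.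
pose Q : {poly R} := (1%:P - r%:P * 'X) ^+ 4.
have dQ (s : R) : Q^`().[s] = - (4 * r * (1 - s * r) ^+ 3).
  rewrite /Q deriv_exp !(derivB, derivC, derivM, derivX).
  by rewrite !(hornerMn, hornerM, horner_exp, hornerD, hornerN, hornerC, hornerX); ring.
have hQ (s : R) : Q.[s] = (1 - s * r) ^+ 4.
  by rewrite /Q !(horner_exp, hornerM, hornerD, hornerN, hornerC, hornerX); ring.
pose h (s : R) := F0 (0 + s *: x) * Q.[s].
pose dh (s : R) := dot x (grad F0 (s *: x)) * (1 - s * r) ^+ 4 -
  F0 (s *: x) * (4 * r * (1 - s * r) ^+ 3).
have hdh (s : R) : 0 <= s <= 1 -> is_derive s (1 : R) h (dh s).
  move=> s01; have [df _] := C0 _ (sB s s01).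
  have D : is_derive s (1 : R) (fun s : R => F0 (0 + s *: x)) (dot x (grad F0 (s *: x))).
    by apply: is_derive_line; rewrite add0r; exact: is_derive_grad.
  have -> : dh s = F0 (0 + s *: x) *: Q^`().[s] + Q.[s] *: dot x (grad F0 (s *: x)).
    rewrite /dh dQ hQ add0r; have scE (a b : R) : a *: b = a * b by [].
    by rewrite !scE; ring.
  exact: is_deriveM D (is_derive_poly Q s).
have dh_le0 (s : R) : 0 <= s <= 1 -> dh s <= 0.
  move=> s01; have := gradient_le x (sB s s01); have /andP[s0 s1] := s01.
  rewrite enorm3Z// -/r /dh subr_le0.
  have sr0 : 0 <= 1 - s * r by nra.
  (* Both sides have the common factor (1 - s r)^3. *)
  have -> : forall a b : R, (a * (1 - s * r) ^+ 4 <= b * (4 * r * (1 - s * r) ^+ 3)) =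
      ((1 - s * r) ^+ 3 * ((1 - s * r) * a) <= (1 - s * r) ^+ 3 * (4 * r * b)).
    by move=> a b; congr (_ <= _); ring.
  by move=> H; rewrite ler_wpM2l ?exprn_ge0.
have hc : {within `[0, 1], continuous h}.
  apply: derivable_within_continuous => s; rewrite in_itv/= => s01.
  by have ? := hdh s s01; exact: ex_derive.
have [s|s s01] := @MVT _ h dh 0 1 ltr01 _ hc.
  by rewrite in_itv/= => /andP[s0 s1]; apply: hdh; rewrite !ltW.
rewrite subr0 mulr1 => E.
have : h 1 <= h 0.
  rewrite -subr_le0 E dh_le0//; move: s01; rewrite in_itv/= => /andP[? ?].
  by rewrite !ltW.
rewrite /h !hQ scale0r scale1r !add0r !(mul0r, mul1r) subr0 expr1n mulr1; exact.
Qed.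

(** [gradient_le] in the direction of the gradient itself. *)
Lemma grad_norm_le (x : R3) : ball3 x ->
  enorm3 (grad F0 x) * (1 - enorm3 x) ^+ 5 <= 4 * F0 0.
Proof.
move=> xB; have x1 : enorm3 x < 1 by [].
have := gradient_le (grad F0 x) xB; have := harnack_upper xB.
have -> : dot (grad F0 x) (grad F0 x) = enorm3 (grad F0 x) ^+ 2.
  by rewrite enorm3_sqr dotxx.
have F00 : 0 <= F0 0.
  by apply: F0_ge0; exact: ball3_0.
have := enorm3_ge0 (grad F0 x); set g := enorm3 (grad F0 x); rewrite le_eqVlt.
move=> /predU1P[<- _ _|g0 H G]; first by rewrite mul0r mulr_ge0.
have d0 : 0 < 1 - enorm3 x by rewrite subr_gt0.
have {}G : (1 - enorm3 x) * g <= 4 * F0 x.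
  by rewrite -(ler_pM2r g0); move: G; rewrite expr2 !mulrA [4 * g * _]mulrAC.
rewrite (_ : g * _ = (1 - enorm3 x) ^+ 4 * ((1 - enorm3 x) * g)); last ring.
apply: le_trans (_ : (1 - enorm3 x) ^+ 4 * (4 * F0 x) <= _).
  by rewrite ler_wpM2l// exprn_ge0// ltW.
by rewrite mulrCA ler_pM2l// mulrC.
Qed.

End PositiveHarmonic.

(** * Monogenic functions *)

Section AffineC1.
Context {R : realType}.
Local Notation R3 := (R * R * R)%type.

Lemma grad_affine (f : R3 -> R) (a b : R) x : differentiable f x ->
  grad (fun y => b + a * f y) x = a *: grad f x.
Proof.
move=> df; have D v : 'D_v (fun y => b + a * f y) x = a * 'D_v f x.
  have dv : derivable f x v by exact: diff_derivable.
  have := is_deriveD (is_derive_cst b x v)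
    (is_deriveM (is_derive_cst a x v) (DeriveDef dv (erefl _))).
  rewrite scaler0 addr0 add0r => H.
  by rewrite -[LHS]/('D_v (cst b + cst a * f) x) derive_val.
by rewrite /grad !D.
Qed.

Lemma C1_affine (f : R3 -> R) (a b : R) : C1_ball f -> C1_ball (fun y => b + a * f y).
Proof.
move=> fC x xB; have [df cf] := fC x xB.
have FF : Filter (nbhs x) by exact: nbhs_filter.
split.
  by apply: differentiableD => //; apply: differentiableM.
rewrite /prop_for /continuous_at (grad_affine _ _ df).
apply: (@cvg_trans _ (a *: grad f y @[y --> x])).
  apply: near_eq_cvg; apply: (@filterS _ _ FF _ _ _ (near_ball3 xB)) => y yB.
  by rewrite grad_affine//; have [] := fC y yB.
by apply: (@cvgZ _ (R * R * R)%type _ _ FF (cst a) (grad f)); [exact: cvg_cst|exact: cf].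
Qed.

End AffineC1.

Lemma e1_mulE (R : realType) (q : quat R) :
  (((e1 R * q)`[0]q = - q`[1]q) * ((e1 R * q)`[1]q = q`[0]q) *
   ((e1 R * q)`[2]q = - q`[3]q)).
Proof. by split; [split|]; rewrite /GRing.mul /= !mkquatE; ring. Qed.

Lemma e2_mulE (R : realType) (q : quat R) :
  (((e2 R * q)`[0]q = - q`[2]q) * ((e2 R * q)`[1]q = q`[3]q) *
   ((e2 R * q)`[2]q = q`[0]q)).
Proof. by split; [split|]; rewrite /GRing.mul /= !mkquatE; ring. Qed.

Lemma cauchy_riemann_coordinates (R : realType) (p0 p1 p2 : quat R) :
  p0 + e1 R * p1 + e2 R * p2 = 0 ->
  [/\ p0`[0]q - p1`[1]q - p2`[2]q = 0, p0`[1]q + p1`[0]q + p2`[3]q = 0 &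
      p0`[2]q - p1`[3]q + p2`[0]q = 0].
Proof.
move=> E; have coord i : qcoord (p0 + e1 R * p1 + e2 R * p2) i = 0.
  by rewrite E /qcoord mxE.
have := coord (inord 0); have := coord (inord 1); have := coord (inord 2).
by rewrite !qcoordD !e1_mulE !e2_mulE; split.
Qed.

Section Monogenic.
Context {R : realType}.
Local Notation R3 := (R * R * R)%type.
Variable f : R3 -> quat R.
Hypothesis fmono : monogenic_on (@ball3 R) f.

Definition component (i : 'I_4) (y : R3) : R := qcoord (f y) i.

Lemma partialE (v x : R3) i : qcoord (partial v f x) i = 'D_v (component i) x.
Proof. by rewrite /qcoord /partial mxE. Qed.

Lemma C1_component i : C1_ball (component i).
Proof.
have [_ fC1 _] := fmono; move=> x xB; have [df cf] := fC1 x xB i; split=> //.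
have cD v : v \in [:: dir0 R; dir1 R; dir2 R] ->
    'D_v (component i) y @[y --> x] --> 'D_v (component i) x.
  move=> vd; rewrite -partialE.
  rewrite (_ : (fun y => _) = fun y => qcoord (partial v f y) i); last first.
    by apply/funext => y; rewrite partialE.
  exact: (cf v vd).
have c0 : 'D_(dir0 R) (component i) y @[y --> x] --> 'D_(dir0 R) (component i) x.
  by apply: cD; rewrite !inE eqxx.
have c1 : 'D_(dir1 R) (component i) y @[y --> x] --> 'D_(dir1 R) (component i) x.
  by apply: cD; rewrite !inE eqxx orbT.
have c2 : 'D_(dir2 R) (component i) y @[y --> x] --> 'D_(dir2 R) (component i) x.
  by apply: cD; rewrite !inE eqxx !orbT.
have FF : Filter (nbhs x) by exact: nbhs_filter.
have c01 := @cvg_pair _ _ _ _ _ _ FF _ _ _ _ c0 c1.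
exact: (@cvg_pair _ _ _ _ _ _ FF _ _ _ _ (c01 _ _) c2).
Qed.

Lemma derive_component3 v x : ball3 x -> 'D_v (component (inord 3)) x = 0.
Proof.
have [f3 _ _] := fmono; move=> xB.
have FF : Filter (nbhs x) by exact: nbhs_filter.
(* f is reduced only on the ball, which is a neighborhood of x. *)
have near0 : \forall y \near x, cst 0 y = component (inord 3) y.
  by apply: (@filterS _ _ FF _ _ _ (near_ball3 xB)) => y yB; rewrite /component f3.
have H := near_eq_is_derive near0 (is_derive_cst 0 x v).
by rewrite derive_val.
Qed.

Lemma cauchy_riemann_components x : ball3 x ->
  [/\ 'D_(dir0 R) (component (inord 0)) x = 'D_(dir1 R) (component (inord 1)) x +
        'D_(dir2 R) (component (inord 2)) x,
      'D_(dir0 R) (component (inord 1)) x = - 'D_(dir1 R) (component (inord 0)) x &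
      'D_(dir0 R) (component (inord 2)) x = - 'D_(dir2 R) (component (inord 0)) x].
Proof.
move=> xB; have [_ _ /(_ x xB) CR] := fmono.
have [E0 E1 E2] := cauchy_riemann_coordinates CR.
have z1 : (partial (dir1 R) f x)`[3]q = 0 by rewrite partialE derive_component3.
have z2 : (partial (dir2 R) f x)`[3]q = 0 by rewrite partialE derive_component3.
rewrite -!partialE.
move: (partial _ f x) (partial _ f x) (partial _ f x) z1 z2 E0 E1 E2 => p0 p1 p2.
move=> z1 z2 /eqP E0 /eqP E1 /eqP E2.
rewrite z2 addr0 addr_eq0 in E1; rewrite z1 subr0 addr_eq0 in E2.
by rewrite -addrA -opprD subr_eq0 in E0; split; apply/eqP.
Qed.

Lemma hypercomplex_derivative_partial x : ball3 x ->
  hypercomplex_derivative f x = partial (dir0 R) f x.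
Proof.
move=> xB; have [_ _ /(_ x xB)] := fmono.
rewrite /CauchyRiemann -addrA => /eqP; rewrite addr_eq0 => /eqP CR.
rewrite /hypercomplex_derivative /conjCauchyRiemann -addrA -opprD.
by rewrite -[X in _ + X]CR -mulr2n -[partial _ _ _ *+ 2]scaler_nat scalerA mulVf ?scale1r.
Qed.

(** The derivatives along x0 of the coordinates f1, f2 are those of - f0 along
    x1, x2. *)
Lemma qnorm_hypercomplex_derivative x : ball3 x ->
  qnorm (hypercomplex_derivative f x) = enorm3 (grad (component (inord 0)) x).
Proof.
move=> xB; have [_ E1 E2] := cauchy_riemann_components xB.
rewrite hypercomplex_derivative_partial// /qnorm /enorm3; congr Num.sqrt.
rewrite !big_ord_recl big_ord0 addr0.
have o0 : (ord0 : 'I_4) = inord 0 by apply/val_inj; rewrite /= inordK.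
have o1 : lift ord0 (ord0 : 'I_3) = inord 1 by apply/val_inj; rewrite /= inordK.
have o2 : lift ord0 (lift ord0 (ord0 : 'I_2)) = inord 2 by apply/val_inj; rewrite /= inordK.
have o3 : lift ord0 (lift ord0 (lift ord0 (ord0 : 'I_1))) = inord 3.
  by apply/val_inj; rewrite /= inordK.
rewrite o1 o2 o3 o0 !partialE E1 E2 derive_component3//=.
by rewrite !sqrrN expr0n addr0 addrA.
Qed.

Lemma Sc_le_qnorm (q : quat R) : `|Sc q| <= qnorm q.
Proof.
rewrite /Sc /qnorm -sqrtr_sqr ler_wsqrtr//.
rewrite (bigD1 (inord 0))//= lerDl sumr_ge0// => i _; exact: sqr_ge0.
Qed.

(** The conjugate functions are minus the other two coordinates of f, up to the
    factor a; they are written as affine images so that [C1_affine] applies to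
    all three functions. *)
Lemma riesz_component (a M : R) :
  riesz (fun y => M + a * component (inord 0) y) (fun y => 0 + - a * component (inord 1) y)
    (fun y => 0 + - a * component (inord 2) y).
Proof.
split; try by apply: C1_affine; exact: C1_component.
move=> x xB; have [E0 E1 E2] := cauchy_riemann_components xB.
have d i : differentiable (component i) x by have [] := C1_component i xB.
rewrite !grad_affine// !(dotC (dir0 R)) !(dotC (dir1 R)) !(dotC (dir2 R)) !dotZl.
rewrite !(dotC _ (dir0 R)) !(dotC _ (dir1 R)) !(dotC _ (dir2 R)).
rewrite !(dot0E, dot1E, dot2E) /grad /= E0 E1 E2.
by split; ring.
Qed.

(** [grad_norm_le] for u = M + a f0, where the sign a makes u(0) equal to
    M - |f0(0)|, while |f0| <= |f| <= M makes u nonnegative. *)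
Lemma hypercomplex_derivative_bound (M : R) x :
  (forall y, ball3 y -> qnorm (f y) <= M) -> ball3 x ->
  qnorm (hypercomplex_derivative f x) * (1 - enorm3 x) ^+ 5 <= 4 * (M - `|Sc (f 0)|).
Proof.
move=> fM xB; rewrite qnorm_hypercomplex_derivative//.
pose a : R := if 0 <= Sc (f 0) then -1 else 1.
have aa : a ^+ 2 = 1 by rewrite /a; case: ifP => _; ring.
have aSc (q : quat R) : - (a * Sc q) <= `|Sc q|.
  by rewrite /a; case: ifP => _; rewrite ?mulN1r ?mul1r ?opprK ?ler_norm// -normrN ler_norm.
have a0 : a * Sc (f 0) = - `|Sc (f 0)|.
  rewrite /a; case: (leP 0 (Sc (f 0))) => s0; first by rewrite mulN1r ger0_norm.
  by rewrite mul1r ltr0_norm// opprK.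
have u_ge0 y : ball3 y -> 0 <= M + a * component (inord 0) y.
  move=> yB; have := aSc (f y); have := Sc_le_qnorm (f y); have := fM y yB.
  by rewrite /component -/(Sc (f y)); lra.
have := grad_norm_le (riesz_component a M) u_ge0 xB.
rewrite grad_affine; last by have [] := C1_component (inord 0) xB.
rewrite /component -/(Sc (f 0)) a0.
suff -> : enorm3 (a *: grad (component (inord 0)) x) = enorm3 (grad (component (inord 0)) x) by [].
by rewrite -[LHS]/(Num.sqrt (norm2 _)) norm2Z aa mul1r.
Qed.

End Monogenic.

Unset Implicit Arguments.

Theorem theorem5p1 (R : realType) (f : R * R * R -> quat R) :
  monogenic_on (@ball3 R) f ->
  square_integrable_on (@ball3 R) f ->
  forall r : R, 0 <= r -> r < 1 ->
  (max_modulus (hypercomplex_derivative f) r <=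
   (8 * (3 * r + 1) / (1 - r) ^+ 5)%:E * (sup_modulus f - `|Sc (f 0)|%:E))%E.
Proof.
move=> fmono _ r r0 r1.
have d0 : 0 < (1 - r) ^+ 5 by rewrite exprn_gt0// subr_gt0.
have C0 : 0 < 8 * (3 * r + 1) / (1 - r) ^+ 5 by rewrite divr_gt0//; lra.
have f_sup y : ball3 y -> ((qnorm (f y))%:E <= sup_modulus f)%E.
  by move=> yB; apply: ereal_sup_ubound; exists y.
have f0_sup := f_sup 0 (@ball3_0 R).
(* The value -oo is excluded by f_sup at 0. *)
case supE : (sup_modulus f) f_sup f0_sup => [M| |] f_sup f0_sup //; last first.
  by rewrite addye// gt0_muley ?leey// lte_fin.
apply: ge_ereal_sup => _ [x /= xr <-].
have xB : ball3 x by rewrite /ball3 /= xr.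
have := @hypercomplex_derivative_bound _ _ fmono M x.
have fM y : ball3 y -> qnorm (f y) <= M by move=> /f_sup; rewrite lee_fin.
move=> /(_ fM xB); rewrite xr => bound.
have M0 : 0 <= M - `|Sc (f 0)|.
  rewrite subr_ge0 (le_trans (Sc_le_qnorm _))//; exact: fM (@ball3_0 R).
rewrite -EFinB -EFinM lee_fin mulrAC ler_pdivlMr// (le_trans bound)//.
by apply: ler_wpM2r => //; lra.
Qed.
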